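(* Let $H\ge 1$, for $h\in\{1,\dots,H\}$ let $\mathcal{N}^{(h)}$ be a parallel network, and let $\mathcal{N}_{\mathrm{ser}}(H)$ be the chain-of-parallel network obtained by composing $\mathcal{N}^{(1)},\dots,\mathcal{N}^{(H)}$ in series. Let $\gamma^{( * )}$ be the capacity of a module $\mathcal{N}^{( * )}\in\{\mathcal{N}^{(1)},\dots,\mathcal{N}^{(H)}\}$ that is a minimum cut of $\mathcal{N}_{\mathrm{ser}}(H)$. Consider the game $\Gamma(\mathcal{N}_{\mathrm{ser}}(H),\gamma^{( * )})$ with uniform inflow $\gamma^{( * )}$. Then $$\mathsf{Opt}\big(\mathcal{N}_{\mathrm{ser}}(H),\gamma^{( * )}\big)=\sum_{h=1}^{H}\mathsf{Opt}\big(\mathcal{N}^{(h)},\gamma^{( * )}\big),$$ $$\mathsf{WEq}\big(\mathcal{N}_{\mathrm{ser}}(H),\gamma^{( * )}\big)=\sum_{h=1}^{H}\mathsf{WEq}\big(\mathcal{N}^{(h)},\gamma^{( * )}\big).$$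
   Context: **Networks.** $\mathbb{N}=\{0,1,2,\dots\}$, $\mathbb{N}_{+}=\{1,2,\dots\}$. A network $\mathcal{N}$ is a finite directed multigraph $(V,E)$ with a unique source $s$ (only outgoing edges) and a unique destination $d$ (only incoming edges), every other vertex lying on some path from $s$ to $d$, where each edge $e$ has a free-flow transit cost $\tau_e\in\mathbb{N}$ and a positive integer capacity $\gamma_e$. A route is a path from $s$ to $d$ (finite sequence of consecutive edges); $\mathcal{R}$ is the set of routes. A parallel network is a network in which each route contains a single edge (all edges go from $s$ to $d$). The series composition of $\mathcal{N}_1$ (source $s_1$, destination $d_1$) and $\mathcal{N}_2$ (source $s_2$, destination $d_2$) is the network with source $s_1$ and destination $d_2$ in which $d_1$ and $s_2$ are merged. A cut is a set $C\subseteq E$ of edges meeting every route; its capacity is $\sum_{e\in C}\gamma_e$; a minimum cut is a cut of minimum capacity. (The edge set $E^{(h)}$ of each module $\mathcal{N}^{(h)}$ is a cut of the series composition, and $\gamma^{( * )}=\min_h\sum_{e\in E^{(h)}}\gamma_e$.) **Game $\Gamma(\mathcal{N},\delta)$.** Time is discrete. At each stage $t\in\mathbb{N}_{+}$ a generation $G_t$ of $\delta$ players departs from $s$; $[it]$ denotes the $i$-th player of $G_t$, and $G=\bigcup_t G_t$. Priority: $[js]\lhd[it]$ iff $s<t$, or $s=t$ and $j<i$. Each player chooses a route; a strategy profile is $\sigma\in\mathcal{R}^{G}$. Player $[it]$ enters the first edge of her route at time $t$. A player entering edge $e$ at time $u$ reaches its head at time $u+\tau_e$, where there may be a queue. Players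 in the queue of $e$ are ordered by time of entry into $e$, ties being broken by the priority $\lhd$ (no overtaking). At each stage at most $\gamma_e$ players, the first ones in the queue, exit $e$: a player who has reached the head exits at that stage if fewer than $\gamma_e$ players are in the queue ahead of her, and otherwise waits one stage and the process repeats. A player exiting $e$ at some stage enters the next edge of her route at the same stage, or leaves the system if she is at $d$. **Latencies.** The latency of $[it]$ is $\ell_{it}(\sigma)=c_{it}(\sigma)+w_{it}(\sigma)$, where $c_{it}(\sigma)$ is the sum of $\tau_e$ over the edges of her route and $w_{it}(\sigma)$ is the total number of stages she spends waiting in queues. Put $\ell_t(\sigma)=\sum_{[it]\in G_t}\ell_{it}(\sigma)$ and $\bar L_T(\sigma)=\frac1T\sum_{t=1}^{T}\ell_t(\sigma)$. **Optimum.** $\sigma$ is socially optimal if $\liminf_{T\to\infty}\bar L_T(\sigma')\ge\limsup_{T\to\infty}\bar L_T(\sigma)$ for all $\sigma'\in\mathcal{R}^G$; $\mathcal{O}(\mathcal{N},\delta)$ is the set of such profiles, and $\mathsf{Opt}(\mathcal{N},\delta)=\lim_{T\to\infty}\bar L_T(\sigma)$ for any $\sigma\in\mathcal{O}(\mathcal{N},\delta)$. **Equilibrium.** $\sigma$ is a Nash equilibrium if $\ell_{it}(\sigma)\le\ell_{it}(\sigma'_{it},\sigma_{-it})$ for every player $[it]\in G$ and every $\sigma'_{it}\in\mathcal{R}$. A Nash equilibrium is a uniformly fastest route (UFR) equilibrium if for every player $[it]$ and every vertex $v$ on her route $\sigma_{it}$ there is no alternative route allowing $[it]$ to arrive at $v$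 earlier than under $\sigma_{it}$ (given $\sigma_{-it}$). $\mathcal{E}(\mathcal{N},\delta)$ is the set of UFR equilibria, and $\mathsf{WEq}(\mathcal{N},\delta)=\sup_{\sigma\in\mathcal{E}(\mathcal{N},\delta)}\limsup_{T\to\infty}\bar L_T(\sigma)$. *)

(* Defs.v *)
From HB Require Import structures.
From mathcomp Require Import all_boot all_order all_algebra.
From mathcomp Require Import all_classical all_reals all_analysis.

Set Implicit Arguments.
Unset Strict Implicit.
Unset Printing Implicit Defensive.

Import Order.TTheory GRing.Theory Num.Theory.
Import numFieldNormedType.Exports.

Local Open Scope nat_scope.

Fixpoint walk (V E : eqType) (tl hd : E -> V) (v w : V) (r : seq E) : bool :=
  if r is e :: r' then (tl e == v) && walk tl hd (hd e) w r' else v == w.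

(* The vertices met by a walk from [v], in order of traversal: the [k]-th one
   is where the walk is after its first [k] edges. *)
Definition walk_vertices (V E : eqType) (hd : E -> V) (v : V) (r : seq E) :
  seq V := v :: map hd r.

(* [net_cover] at [src] (or at [dst]) also says that there is a route. *)
Record network := Network {
  vertex : finType;
  edge : finType;
  etail : edge -> vertex;
  ehead : edge -> vertex;
  src : vertex;
  dst : vertex;
  tau : edge -> nat;
  cap : edge -> nat;
  net_cap_gt0 : forall e, 0 < cap e;
  net_src_neq_dst : src != dst;
  net_src_out : forall e, ehead e != src;
  net_dst_in : forall e, etail e != dst;
  net_cover : forall v, exists2 r,
    walk etail ehead src dst r & v \in walk_vertices ehead src r
}.

Definition is_route (N : network) (r : seq (edge N)) : bool :=
  walk (@etail N) (@ehead N) (src N) (dst N) r.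

Definition route (N : network) : Type := {r : seq (edge N) | is_route r}.

Definition route_vertices (N : network) (r : seq (edge N)) : seq (vertex N) :=
  walk_vertices (@ehead N) (src N) r.

Definition parallel (N : network) : Prop :=
  forall r : seq (edge N), is_route r -> size r = 1.

Definition is_cut (N : network) (C : {set edge N}) : Prop :=
  forall r : seq (edge N), is_route r -> exists2 e, e \in r & e \in C.

Definition capacity (N : network) (C : {set edge N}) : nat :=
  \sum_(e in C) cap e.

Definition is_min_cut (N : network) (C : {set edge N}) : Prop :=
  is_cut C /\ forall C' : {set edge N}, is_cut C' -> capacity C <= capacity C'.

Section Series.
Variables N1 N2 : network.

(* The vertices of [N2] other than its source are kept; the source of [N2] is
   represented by the destination of [N1]. *)
Definition ser_vertex : finType :=
  (vertex N1 + {v : vertex N2 | v != src N2})%type.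

Definition ser_edge : finType := (edge N1 + edge N2)%type.

Definition ser_inr (v : vertex N2) : ser_vertex :=
  if insub v is Some v' then inr v' else inl (dst N1).

Definition ser_tail (e : ser_edge) : ser_vertex :=
  match e with inl e1 => inl (etail e1) | inr e2 => ser_inr (etail e2) end.

Definition ser_head (e : ser_edge) : ser_vertex :=
  match e with inl e1 => inl (ehead e1) | inr e2 => ser_inr (ehead e2) end.

Definition ser_src : ser_vertex := inl (src N1).

Definition ser_dst : ser_vertex := ser_inr (dst N2).

Definition ser_tau (e : ser_edge) : nat :=
  match e with inl e1 => tau e1 | inr e2 => tau e2 end.

Definition ser_cap (e : ser_edge) : nat :=
  match e with inl e1 => cap e1 | inr e2 => cap e2 end.

Lemma ser_inr_src : ser_inr (src N2) = inl (dst N1).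
Proof. by rewrite /ser_inr insubF // eqxx. Qed.

Lemma ser_inrE (v : vertex N2) (hv : v != src N2) :
  ser_inr v = inr (exist _ v hv).
Proof. by rewrite /ser_inr (insubT (fun v => v != src N2) hv). Qed.

Lemma ser_cap_gt0 e : 0 < ser_cap e.
Proof. by case: e => e; apply: net_cap_gt0. Qed.

Lemma ser_inr_neq_src v : ser_inr v != ser_src.
Proof.
have [->|hv] := eqVneq v (src N2); last by rewrite (ser_inrE hv).
rewrite ser_inr_src /ser_src; apply: contra (net_src_neq_dst N1).
by move=> /eqP[->].
Qed.

Lemma ser_src_neq_dst : ser_src != ser_dst.
Proof. by rewrite eq_sym ser_inr_neq_src. Qed.

Lemma ser_src_out e : ser_head e != ser_src.
Proof.
case: e => e; last exact: ser_inr_neq_src.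
by rewrite /ser_src /=; apply: contra (net_src_out e) => /eqP[->].
Qed.

Lemma ser_dst_in e : ser_tail e != ser_dst.
Proof.
have dN : dst N2 != src N2 by rewrite eq_sym net_src_neq_dst.
rewrite /ser_dst (ser_inrE dN); case: e => e //=.
have [->|hv] := eqVneq (etail e) (src N2); first by rewrite ser_inr_src.
rewrite (ser_inrE hv); apply: contra (net_dst_in e).
by move=> /eqP[->].
Qed.

Lemma walk_cat (V E : eqType) (tl hd : E -> V) u v w (r1 r2 : seq E) :
  walk tl hd u v r1 -> walk tl hd v w r2 -> walk tl hd u w (r1 ++ r2).
Proof.
elim: r1 u => [|e r1 IH] u /=; first by move=> /eqP->.
by move=> /andP[-> h1] h2 /=; apply: IH.
Qed.

Lemma walk_map (V E V' E' : eqType) (tl hd : E -> V) (tl' hd' : E' -> V')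
    (f : V -> V') (g : E -> E') u v (r : seq E) :
  (forall e, tl' (g e) = f (tl e)) -> (forall e, hd' (g e) = f (hd e)) ->
  walk tl hd u v r -> walk tl' hd' (f u) (f v) (map g r).
Proof.
move=> ht hh; elim: r u => [|e r IH] u /=; first by move=> /eqP->.
by move=> /andP[/eqP<- h]; rewrite ht eqxx hh; apply: IH.
Qed.

Lemma ser_route r1 r2 : is_route r1 -> is_route r2 ->
  walk ser_tail ser_head ser_src ser_dst (map inl r1 ++ map inr r2).
Proof.
move=> h1 h2; apply: (@walk_cat _ _ _ _ _ (inl (dst N1))).
  exact: (walk_map (tl' := ser_tail) (hd' := ser_head) (f := inl) _ _ h1).
rewrite -ser_inr_src.
exact: (walk_map (tl' := ser_tail) (hd' := ser_head) (f := ser_inr) _ _ h2).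
Qed.

Lemma ser_cover v : exists2 r, walk ser_tail ser_head ser_src ser_dst r
  & v \in walk_vertices ser_head ser_src r.
Proof.
case: v => [v|[v hv]].
  have [r1 h1 v1] := net_cover v; have [r2 h2 _] := net_cover (src N2).
  exists (map inl r1 ++ map inr r2); first exact: ser_route.
  move: v1; rewrite /walk_vertices !in_cons => /orP[/eqP->|/mapP[e er ->]].
    by rewrite eqxx.
  apply/orP; right; apply/mapP; exists (inl e) => //.
  by rewrite mem_cat map_f.
have [r1 h1 _] := net_cover (src N1); have [r2 h2 v2] := net_cover v.
exists (map inl r1 ++ map inr r2); first exact: ser_route.
move: v2; rewrite /walk_vertices !in_cons (negPf hv) /= => /mapP[e er ve].
apply/mapP; exists (inr e); first by rewrite mem_cat (map_f inr er) orbT.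
by rewrite /= -ve (ser_inrE hv).
Qed.

Definition ser_comp : network :=
  Network ser_tau ser_cap_gt0 ser_src_neq_dst ser_src_out ser_dst_in ser_cover.

End Series.

(* The series composition of [N 0], ..., [N n], that is, of n + 1 modules. *)
Fixpoint chain (N : nat -> network) (n : nat) : network :=
  if n is n'.+1 then ser_comp (chain N n') (N n) else N 0.

Definition Nser (N : nat -> network) (H : nat) : network := chain N H.-1.

Fixpoint chain_module (N : nat -> network) (n : nat) :
    edge (chain N n) -> nat :=
  match n return edge (chain N n) -> nat with
  | 0 => fun _ => 0
  | n'.+1 => fun e : ser_edge (chain N n') (N n'.+1) =>
      match e with inl e1 => chain_module e1 | inr _ => n'.+1 end
  end.

Definition module_edges (N : nat -> network) (H h : nat) :
    {set edge (Nser N H)} :=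
  [set e | chain_module e == h].

(* Both components count from 0: the player (t, i) is the (i + 1)-th player of
   the generation departing at stage t + 1. *)
Definition player (delta : nat) : Type := (nat * 'I_delta)%type.

Definition departure (delta : nat) (p : player delta) : nat := p.1.+1.

Definition prior (delta : nat) (q p : player delta) : bool :=
  (q.1 < p.1) || (q.1 == p.1) && (q.2 < p.2).

Definition profile (N : network) (delta : nat) : Type :=
  player delta -> route N.

Definition edges_of (N : network) (delta : nat) (sigma : profile N delta)
  (p : player delta) : seq (edge N) := sval (sigma p).

Definition deviate (N : network) (delta : nat) (sigma : profile N delta)
    (p : player delta) (r : route N) : profile N delta :=
  fun q => if q == p then r else sigma q.

(* [x p k] is the stage at which [p] enters the [k]-th edge of her route
   (counting from 0) for [k] less than the length of the route, and the stage at
   which she leaves the system for [k] equal to that length. So [x p k.+1] is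
   the stage at which she exits the [k]-th edge. *)
Definition timing (delta : nat) : Type := player delta -> nat -> nat.

(* Whether [q], on the [j]-th edge of her route, is in the queue of [e] at
   stage [u], those who exit at stage [u] being included. *)
Definition queued (N : network) (delta : nat) (sigma : profile N delta)
    (x : timing delta) (e : edge N) (u : nat) (q : player delta) (j : nat) :
    bool :=
  [&& onth (edges_of sigma q) j == Some e, x q j + tau e <= u & u <= x q j.+1].

Definition ahead (delta : nat) (x : timing delta) (q : player delta) (j : nat)
    (p : player delta) (k : nat) : bool :=
  (x q j < x p k) || (x q j == x p k) && prior q p.

(* The players who have departed by stage [u] are the (s, i) with s < u. *)
Definition num_ahead (N : network) (delta : nat) (sigma : profile N delta)
    (x : timing delta) (e : edge N) (u : nat) (p : player delta) (k : nat) :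
    nat :=
  \sum_(s < u) \sum_(i < delta)
    \sum_(j < size (edges_of sigma (s : nat, i)))
      (queued sigma x e u (s : nat, i) j && ahead x (s : nat, i) j p k).

Definition is_timing (N : network) (delta : nat) (sigma : profile N delta)
    (x : timing delta) : Prop :=
  forall p : player delta,
    x p 0 = departure p /\
    forall (k : nat) (e : edge N), onth (edges_of sigma p) k = Some e ->
      x p k + tau e <= x p k.+1 /\
      forall u : nat, queued sigma x e u p k ->
        (x p k.+1 == u) = (num_ahead sigma x e u p k < cap e).

(* In a network without directed cycles, in particular in a series composition
   of parallel networks, the queueing rules determine the timing up to the
   irrelevant values [x p k] with [k] greater than the length of the route of
   [p]: take the edges along the directed paths and, on each edge, the players
   in the order of its queue. *)
Definition outcome (N : network) (delta : nat) (sigma : profile N delta) :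
    timing delta :=
  xget (fun _ _ => 0) [set x | is_timing sigma x]%classic.

Definition transit_cost (N : network) (delta : nat) (sigma : profile N delta)
    (p : player delta) : nat :=
  \sum_(e <- edges_of sigma p) tau e.

Definition waiting_time (N : network) (delta : nat) (sigma : profile N delta)
    (p : player delta) : nat :=
  \sum_(k < size (edges_of sigma p))
    (outcome sigma p k.+1 -
      (outcome sigma p k + tau (tnth (in_tuple (edges_of sigma p)) k))).

Definition latency (N : network) (delta : nat) (sigma : profile N delta)
    (p : player delta) : nat :=
  transit_cost sigma p + waiting_time sigma p.

(* Generation [t] here departs at stage t + 1. *)
Definition gen_latency (N : network) (delta : nat) (sigma : profile N delta)
    (t : nat) : nat :=
  \sum_(i < delta) latency sigma (t, i).

Definition avg_latency (R : realType) (N : network) (delta : nat)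
    (sigma : profile N delta) (T : nat) : \bar R :=
  ((\sum_(t < T) gen_latency sigma t)%:R / T%:R)%R%:E.

Definition socially_optimal (R : realType) (N : network) (delta : nat)
    (sigma : profile N delta) : Prop :=
  forall sigma' : profile N delta,
    (limn_esup (avg_latency R sigma) <= limn_einf (avg_latency R sigma'))%E.

(* There is at most one such limit, as all socially optimal profiles have the
   same one. *)
Definition Opt (R : realType) (N : network) (delta : nat) : \bar R :=
  xget -oo%E
    [set v | exists2 sigma : profile N delta, socially_optimal R sigma
             & (avg_latency R sigma @ \oo --> v)%classic]%classic.

Definition nash (N : network) (delta : nat) (sigma : profile N delta) : Prop :=
  forall (p : player delta) (r : route N),
    latency sigma p <= latency (deviate sigma p r) p.

(* The stage at which [p] gets past the queue of the edge leading to [v] on her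
   route, and her departure if [v] is the source. *)
Definition arrival (N : network) (delta : nat) (sigma : profile N delta)
    (p : player delta) (v : vertex N) : nat :=
  outcome sigma p (index v (route_vertices (edges_of sigma p))).

Definition ufr (N : network) (delta : nat) (sigma : profile N delta) : Prop :=
  nash sigma /\
  forall (p : player delta) (v : vertex N),
    v \in route_vertices (edges_of sigma p) ->
    forall r : route N, v \in route_vertices (sval r) ->
      arrival sigma p v <= arrival (deviate sigma p r) p v.

Definition WEq (R : realType) (N : network) (delta : nat) : \bar R :=
  ereal_sup
    [set limn_esup (avg_latency R sigma)
    | sigma in [set sigma : profile N delta | ufr sigma]]%classic.

(* Main.v *)
(* Every route of the chain uses exactly one edge of each module, so a timing is
   computed module by module, and within a module in the order of the queues.
   Let [lam h] be the least [l] such that the edges of module [h] of transit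
   cost at most [l] can carry the inflow [delta].

   Optimum: giving the [i]-th player of every generation the same route, with
   the cheapest edges of each module filled first, causes no waiting.
   Conversely, a player whose latency is at most [sum_h lam h] leaves her edge
   of module [h] within a bounded delay, so that the edges of cost at most
   [l < lam h] serve at most their capacity per stage, up to an additive
   constant; the other players pay at least [sum_h lam h] anyway.

   Equilibrium: a profile is UFR iff in each module each player takes an edge
   with the earliest exit, given the players queued before her.  Then the
   players reach all junctions in order of priority, and each of them is past
   module [h] at most [lam 0 + ... + lam h] stages after her departure.  If
   moreover ties are broken in favour of the edges of cost less than [lam h],
   whose total capacity is less than [delta], these edges end up saturated, and
   from some generation on every player pays exactly [lam h] in module [h].

   So both values are sums over the modules of quantities that only depend on
   the module, and a single module is itself a chain. *)
Require Import Defs.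
From mathcomp Require Import all_boot all_order all_algebra.
From mathcomp Require Import all_classical all_reals all_analysis.
From mathcomp Require Import zify.

Set Implicit Arguments.
Unset Strict Implicit.
Unset Printing Implicit Defensive.

Import Order.TTheory GRing.Theory Num.Theory.
Import numFieldNormedType.Exports.

Local Open Scope nat_scope.

(** * Queues *)

Section Count.
Variable delta : nat.
Implicit Types (P Q : pred (player delta)) (p q : player delta).

Definition cnt (n : nat) P : nat :=
  \sum_(s < n) \sum_(i < delta) P (s : nat, i).

(** The truncations may differ: both sums are extended to [maxn n n'] generations, each bound moving
    into the predicate. *)
Lemma cnt_leq n n' P P' :
  (forall q, q.1 < n -> P q -> (q.1 < n') && P' q) -> cnt n P <= cnt n' P'.
Proof.
move=> h; pose f m (Q : pred (player delta)) :=
  \sum_(s < maxn n n') \sum_(i < delta) ((s < m) && Q (s : nat, i)).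
have cntE m Q : m <= maxn n n' -> cnt m Q = f m Q.
  move=> hm; rewrite /cnt.
  rewrite (big_ord_widen _ (fun s => \sum_(i < delta) Q (s, i)) hm).
  rewrite big_mkcond /f; apply: eq_bigr => s _.
  by case: (s < m) => //=; rewrite big1.
rewrite !cntE ?leq_maxl ?leq_maxr //.
apply: leq_sum => s _; apply: leq_sum => i _.
case: (ltnP s n) => //= sn; case Pq: (P _) => //=.
by have /= := h (s : nat, i) sn Pq => ->.
Qed.

Lemma eq_cnt n n' P P' :
  (forall q, (q.1 < n) && P q = (q.1 < n') && P' q) -> cnt n P = cnt n' P'.
Proof.
move=> h; apply/eqP; rewrite eqn_leq.
apply/andP; split; apply: cnt_leq => q qn Pq.
  by rewrite -h qn.
by rewrite h qn.
Qed.

Lemma cnt_gt0 n P : 0 < cnt n P -> exists2 q, q.1 < n & P q.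
Proof.
move=> c0; apply: contrapT => h; move: c0.
rewrite /cnt big1 // => s _; rewrite big1 // => i _.
case Pq: (P _) => //; case: h; exists (s : nat, i) => //=.
Qed.

Lemma cntT n : cnt n xpredT = n * delta.
Proof.
rewrite /cnt (eq_bigr (fun=> delta)) => [|s _].
  by rewrite big_const_ord iter_addn_0 mulnC.
by rewrite big_const_ord iter_addn_0 mul1n.
Qed.

Lemma cntD n P Q : cnt n P + cnt n (fun q => ~~ P q && Q q) =
  cnt n (fun q => P q || Q q).
Proof.
rewrite /cnt -big_split; apply: eq_bigr => s _; rewrite -big_split /=.
by apply: eq_bigr => i _; case: (P _); case: (Q _).
Qed.

Lemma cnt_rem n P p : cnt n P <= cnt n (fun q => P q && (q != p)) + 1.
Proof.
have -> : cnt n P = cnt n (fun q => (P q && (q != p)) || ((q == p) && P q)).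
  by apply: eq_cnt => q; case: eqP; case: (P q).
rewrite -cntD leq_add2l.
apply: leq_trans (_ : cnt p.1.+1 (pred1 p) <= _).
  apply: cnt_leq => q _ /and3P[_ /eqP -> _] /=.
  by rewrite ltnSn eqxx.
rewrite /cnt big_ord_recr /= big1 ?add0n => [|s _].
  rewrite (bigD1 p.2) //= big1 => [|i ip]; first by case: (_ == _).
  by case: eqP => // -[/esym pe]; rewrite pe /= eqxx in ip.
rewrite big1 // => i _; case: eqP => // /(congr1 fst) /= ps.
by have := ltn_ord s; rewrite [X in X < _]ps ltnn.
Qed.

Lemma cnt_lt_gen p n P : (forall q, P q -> q.1 = p.1 /\ q != p) ->
  cnt n P < delta.
Proof.
move=> hP.
apply: (@leq_ltn_trans (cnt p.1.+1 (fun q => (q.1 == p.1) && (q != p)))).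
  by apply: cnt_leq => q _ /hP[-> ->]; rewrite ltnSn eqxx.
rewrite /cnt big_ord_recr /= big1 ?add0n => [|s _].
  rewrite (bigD1 p.2) //= -surjective_pairing !eqxx add0n.
  apply: (@leq_ltn_trans (\sum_(i < delta | i != p.2) 1)).
    by apply: leq_sum => i _; case: (_ && _).
  by rewrite sum1_card cardC1 card_ord; have := ltn_ord p.2; lia.
by rewrite big1 // => i _; rewrite (ltn_eqF (ltn_ord s)).
Qed.

Lemma cnt_late T K : K * delta <= cnt (T + K) (fun q => T <= q.1).
Proof.
have := cntD (T + K) (fun q => T <= q.1) (fun q => q.1 < T).
rewrite [X in _ = X](_ : _ = (T + K) * delta); last first.
  by rewrite -cntT; apply: eq_cnt => q /=; lia.
have : cnt (T + K) (fun q => ~~ (T <= q.1) && (q.1 < T)) <= T * delta.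
  by rewrite -cntT; apply: cnt_leq => q _ /andP[_ ->].
by rewrite mulnDl; lia.
Qed.

Lemma cnt_partition (E : finType) (A : pred E) (g : player delta -> E) n P :
  \sum_(e | A e) cnt n (fun q => P q && (g q == e)) =
  cnt n (fun q => P q && A (g q)).
Proof.
rewrite /cnt exchange_big; apply: eq_bigr => s _.
rewrite exchange_big; apply: eq_bigr => i _ /=.
case: (P _) => /=; last by rewrite big1.
case Ag: (A _).
  rewrite (bigD1 (g (s : nat, i))) //= eqxx big1 // => e /andP[_ /negPf].
  by rewrite eq_sym => ->.
by rewrite big1 // => e Ae; case: eqP => // ge; rewrite ge Ae in Ag.
Qed.

End Count.

(** Recursion with fuel: [G n p] no longer depends on [n] once [m p < n]. It yields exit stages, and
    later greedy choices, in queue order. *)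
Lemma measure_fix (T A : Type) (a0 : A) (m : T -> nat)
    (F : T -> (T -> A) -> A) :
  (forall p g g', (forall q, m q < m p -> g q = g' q) -> F p g = F p g') ->
  exists g, forall p, g p = F p g.
Proof.
move=> hF.
pose G := fix G n := if n is n'.+1 then fun p => F p (G n') else fun=> a0.
have GE n : forall n' p, m p < n -> m p < n' -> G n p = G n' p.
  elim: n => // n IH [|n'] p //= pn pn'; apply: hF => q qp.
  by apply: IH; apply: leq_trans qp _.
exists (fun p => G (m p).+1 p) => p.
by apply: (hF p (G (m p))) => q qp; apply: GE.
Qed.

(** * One layer of edges with given stages of entry *)

Section Queue.
Variables (E : finType) (tau cap : E -> nat) (delta : nat).
Hypothesis cap_gt0 : forall e, 0 < cap e.
Implicit Types (a y : player delta -> nat) (g : player delta -> E).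
Implicit Types (p q r : player delta) (e : E).

Definition before a q p : bool := (a q < a p) || (a q == a p) && prior q p.

Lemma prior_irr p : prior p p = false.
Proof. by rewrite /prior !ltnn andbF. Qed.

Lemma prior_total p q : [|| prior p q, prior q p | p == q].
Proof.
case: p q => [s i] [t j]; rewrite /prior /= xpair_eqE -val_eqE /=.
by case: (ltngtP s t); case: (ltngtP i j).
Qed.

Lemma prior_gen q p : prior q p -> q.1 <= p.1.
Proof. by case: p q => [s i] [t j]; rewrite /prior /=; lia. Qed.

Lemma gen_prior q p : q.1 < p.1 -> prior q p.
Proof. by rewrite /prior => ->. Qed.

Lemma prior_trans q p r : prior p q -> prior q r -> prior p r.
Proof. by move: p q r => [s i] [t j] [u k]; rewrite /prior /=; lia. Qed.

Lemma prior_asym p q : prior p q -> prior q p = false.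
Proof. by case: p q => [s i] [t j]; rewrite /prior /=; lia. Qed.

Lemma before_total a p q : [|| before a p q, before a q p | p == q].
Proof.
by rewrite /before; have := prior_total p q; case: (ltngtP (a p) (a q)).
Qed.

Lemma before_irr a p : before a p p = false.
Proof. by rewrite /before ltnn prior_irr andbF. Qed.

Lemma before_entry a q p : before a q p -> a q <= a p.
Proof. by rewrite /before; case/orP => [/ltnW //|/andP[/eqP->]]. Qed.

Lemma before_trans a q p r : before a p q -> before a q r -> before a p r.
Proof.
rewrite /before => /orP[pq|/andP[/eqP -> pq]] /orP[qr|/andP[/eqP qr' qr]].
- by rewrite (ltn_trans pq qr).
- by rewrite -qr' pq.
- by rewrite qr.
- by rewrite qr' eqxx (prior_trans pq qr) orbT.
Qed.

(* The square makes this strictly increasing along [before a] when [q.1 < a q]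
   for all [q]. *)
Definition rank a q : nat := (a q * a q + q.1) * delta + q.2.

Lemma before_rank a q p : (forall r, r.1 < a r) -> before a q p ->
  rank a q < rank a p.
Proof.
move=> ha; have := ha q; have := ha p.
case: p q => [t j] [s i]; rewrite /before /rank /prior /=.
set b := a _; set c := a _ => tb sc.
have hi := ltn_ord i; have hj := ltn_ord j.
have lex m n : m < n -> m * delta + i < n * delta + j.
  move=> mn; have : m.+1 * delta <= n * delta by rewrite leq_mul2r mn orbT.
  by rewrite mulSn; lia.
case/orP => [cb|/andP[/eqP ->] /orP[st|/andP[/eqP -> ij]]].
- apply: lex; have : c.+1 * c.+1 <= b * b by apply: leq_mul.
  by rewrite mulSn mulnS; lia.
- by apply: lex; rewrite ltn_add2l.
- by rewrite ltn_add2l.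
Qed.

(** The truncation loses nobody when [q.1 < a q] for all [q]. Once [p] is at the head of [e], so is
    everybody who entered [e] before her, hence no test for that. *)
Definition load a y g p e (u : nat) : nat :=
  cnt (a p) (fun q => [&& before a q p, g q == e & u <= y q]).

Lemma load_antitone a y g p e u v : u <= v ->
  load a y g p e v <= load a y g p e u.
Proof.
move=> uv; apply: cnt_leq => q -> /and3P[-> -> vy] /=.
exact: leq_trans vy.
Qed.

Lemma exit_subproof a y g p e :
  exists u, (a p + tau e <= u) && (load a y g p e u < cap e).
Proof.
(* [B] bounds the exit stages of all players counted in the load, which is therefore zero after
   stage [B]. *)
pose B := \sum_(s < a p) \sum_(i < delta) y (s : nat, i).
exists (a p + tau e + B.+1); rewrite leq_addr /=.
rewrite [load _ _ _ _ _ _](_ : _ = 0) //; apply/eqP; rewrite -leqn0 leqNgt.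
apply/negP => /cnt_gt0[[s i] /= sp] /and3P[_ _].
suff : y (s, i) <= B by lia.
by rewrite /B (bigD1 (Ordinal sp)) //= (bigD1 i) //= -addnA leq_addr.
Qed.

(* The stage at which [p] exits [e] if she enters it at stage [a p], when those
   before her enter the edges [g] at the stages [a] and exit them at the stages
   [y]. *)
Definition exit a y g p e : nat := ex_minn (exit_subproof a y g p e).

(** The load never increases with the stage, so both conditions defining [exit] persist once they
    hold. *)
Lemma exit_leq a y g p e v :
  (exit a y g p e <= v) = (a p + tau e <= v) && (load a y g p e v < cap e).
Proof.
rewrite /exit; case: ex_minnP => m /andP[m1 m2] hm.
apply/idP/idP => [mv|/hm //].
rewrite (leq_trans m1 mv) /=; apply: leq_ltn_trans m2.
exact: load_antitone.
Qed.

Lemma exit_ge a y g p e : a p + tau e <= exit a y g p e.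
Proof. by have := leqnn (exit a y g p e); rewrite exit_leq => /andP[]. Qed.

(** Whoever delays [p] at a stage [v] also delays [p'], so the load of [p'] dominates; [q.1 < a' p']
    keeps her within its truncation. *)
Lemma leq_exit a y g p e a' y' g' p' :
  a p <= a' p' ->
  (forall v q, before a q p -> g q == e -> v <= y q ->
     [&& q.1 < a' p', before a' q p', g' q == e & v <= y' q]) ->
  exit a y g p e <= exit a' y' g' p' e.
Proof.
move=> ap hq; rewrite exit_leq.
have := leqnn (exit a' y' g' p' e); set v := (X in _ <= X).
rewrite exit_leq => /andP[v1 v2]; apply/andP; split; first lia.
apply: leq_ltn_trans v2; apply: cnt_leq => q _ /and3P[h1 h2 h3].
exact: hq.
Qed.

Lemma exit_congr a y g p e a' y' g' :
  a p = a' p -> (forall q, before a q p = before a' q p) ->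
  (forall q, before a q p -> q.1 < a p -> g q = g' q /\ y q = y' q) ->
  exit a y g p e = exit a' y' g' p e.
Proof.
move=> ap hb hq.
have ll u : load a y g p e u = load a' y' g' p e u.
  rewrite /load ap; apply: eq_cnt => q; case: (ltnP q.1 (a' p)) => //= qp.
  rewrite -hb; case bq: (before _ _ _) => //=.
  by have [||-> ->] := hq q; rewrite ?ap.
have ee v : (exit a y g p e <= v) = (exit a' y' g' p e <= v).
  by rewrite !exit_leq ll ap.
by apply/eqP; rewrite eqn_leq ee leqnn -ee leqnn.
Qed.

(** A fixed-point equation, since the loads involve [y]; it is solved by recursion along the queue
    order. *)
Definition step a g y : Prop := forall p, y p = exit a y g p (g p).

Lemma step_ge a g y p : step a g y -> a p + tau (g p) <= y p.
Proof. by move=> st; rewrite st exit_ge. Qed.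

Lemma step_valid a g y : (forall q, q.1 < a q) -> step a g y ->
  forall q, q.1 < y q.
Proof. by move=> ha st q; have := step_ge q st; have := ha q; lia. Qed.

Lemma step_ex a g : (forall q, q.1 < a q) -> exists y, step a g y.
Proof.
move=> ha; apply: (measure_fix 0 (m := rank a)
  (F := fun p y => exit a y g p (g p))) => p y y' hy.
by apply: exit_congr => // q qp _; split=> //; apply/hy/before_rank.
Qed.

(** An induction on [rank] never leaves [S], which contains everybody ahead of its members. Below,
    [S] is everybody, those queued before a deviator, or those prior to her. *)
Lemma step_agree (S : pred (player delta)) a g y a' g' y' :
  (forall q, q.1 < a q) -> step a g y -> step a' g' y' ->
  (forall p, S p -> a p = a' p /\ g p = g' p) ->
  (forall p q, S p -> before a q p = before a' q p) ->
  (forall p q, S p -> before a q p -> S q) ->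
  forall p, S p -> y p = y' p.
Proof.
move=> ha st st' hS hb hd p.
have [n] := ubnP (rank a p); elim: n p => // n IH p pn Sp.
have [ap gp] := hS p Sp.
rewrite st st' -gp; apply: exit_congr => // [q|q qp _]; first exact: hb.
have Sq := hd _ _ Sp qp; split; first by case: (hS q Sq).
apply: IH => //; exact: leq_trans (before_rank ha qp) _.
Qed.

(** Take the last in the queue among those counted: all the others are in her load, which is below
    [cap e]. *)
Lemma exit_rate a g y n e u : (forall q, q.1 < a q) -> step a g y ->
  cnt n (fun q => (g q == e) && (y q == u)) <= cap e.
Proof.
move=> ha st; set P := fun q => _.
case: (posnP (cnt n P)) => [->//|/cnt_gt0[p0 p0n Pp0]].
have [p [pn Pp pmax]] : exists p, [/\ p.1 < n, P p &
    forall q, q.1 < n -> P q -> rank a q <= rank a p].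
  pose f (w : 'I_n * 'I_delta) : player delta := (w.1 : nat, w.2).
  have Pf : P (f (Ordinal p0n, p0.2)) by rewrite /f -surjective_pairing.
  have [w Pw wmax] := @arg_maxnP _ _ (P \o f) (rank a \o f) Pf.
  exists (f w); split=> // [|[s i]]; first exact: ltn_ord.
  move=> /= sn Ps.
  exact: (wmax (Ordinal sn, i)).
move: (Pp) => /andP[/eqP gp /eqP yp].
have : exit a y g p e <= u by rewrite -gp -st yp.
rewrite exit_leq => /andP[_ ld]; apply: leq_trans ld.
apply: leq_trans (cnt_rem _ _ p) _; rewrite addn1 ltnS.
apply: cnt_leq => q qn /andP[Pq qp].
have bq : before a q p.
  have := before_total a p q; rewrite [p == q]eq_sym (negPf qp) orbF.
  by case/orP => // /(before_rank ha); have := pmax q qn Pq; lia.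
move: (Pq) => /andP[-> /eqP ->]; rewrite bq leqnn !andbT.
exact: leq_trans (ha q) (before_entry bq).
Qed.

Lemma exit_rate_leq a g y n e m : (forall q, q.1 < a q) -> step a g y ->
  cnt n (fun q => (g q == e) && (y q < m)) <= cap e * m.
Proof.
move=> ha st; elim: m => [|m IH].
  rewrite leqNgt muln0; apply/negP => /cnt_gt0[q _].
  by rewrite ltn0 andbF.
rewrite mulnS addnC; apply: leq_trans (leq_add IH (exit_rate n e m ha st)).
rewrite (_ : cnt n (fun q => _ && (y q == m)) = cnt n (fun q =>
  ~~ ((g q == e) && (y q < m)) && ((g q == e) && (y q == m)))).
  rewrite cntD; apply: cnt_leq => q -> /andP[-> h] /=; lia.
by apply: eq_cnt => q; case: (g q == e) => //=; lia.
Qed.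

End Queue.

(** * Greedy choices in one module *)

Section Greedy.
Variables (E : finType) (tau cap : E -> nat) (delta : nat).
Hypothesis cap_gt0 : forall e, 0 < cap e.
Implicit Types (a y : player delta -> nat) (g : player delta -> E).
Implicit Types (p q r : player delta) (e : E).

Local Notation exit := (exit tau cap_gt0).
Local Notation step := (step tau cap_gt0).

Definition orderly a : Prop := forall p q, prior p q -> a p <= a q.

(** [A] is the edge set of a module. The exits compared depend only on the players before [p], so
    greedy choices can be made one by one. *)
Definition greedy (A : pred E) a g y : Prop :=
  forall p e, A e -> y p <= exit a y g p e.

Lemma orderly_before a q p : orderly a -> before a q p -> prior q p.
Proof.
move=> oa; rewrite /before => /orP[ap|/andP[_ //]].
case/or3P: (prior_total p q) => [/oa|//|/eqP pq]; first lia.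
by rewrite pq ltnn in ap.
Qed.

Lemma before_prior a r p q : a p <= a q -> prior p q -> before a r p ->
  before a r q.
Proof.
rewrite /before => pq pr /orP[|/andP[/eqP -> rp]]; first lia.
by rewrite (prior_trans rp pr) andbT orbC -leq_eqVlt.
Qed.

Lemma load_orderly a y g p q e u : a p <= a q -> prior p q ->
  load a y g p e u <= load a y g q e u.
Proof.
move=> pq pr; apply: cnt_leq => r rp /and3P[br -> ->].
by rewrite (before_prior pq pr br) !andbT; lia.
Qed.

(** A player prior to [q] could take the edge of [q], entering it no later and with no more players
    ahead. *)
Lemma greedy_orderly (A : pred E) a g y : step a g y -> (forall p, A (g p)) ->
  greedy A a g y -> orderly a -> orderly y.
Proof.
move=> st Ag gr oa p q pq; apply: leq_trans (gr p _ (Ag q)) _.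
have apq := oa _ _ pq.
rewrite exit_leq (st q) (leq_trans _ (exit_ge _ _ _ _ _ _ _)) ?leq_add2r //=.
apply: leq_ltn_trans (load_orderly _ _ _ _ apq pq) _.
by have := leqnn (exit a y g q (g q)); rewrite exit_leq => /andP[].
Qed.

(** If [p] were later, players before her would fill all edges of cost at most [lam] at stage [u].
    By induction earlier generations are gone by then, so fewer than [delta] players would fill a
    capacity of at least [delta]. *)
Lemma greedy_bound (A : pred E) a g y B lam : step a g y ->
  greedy A a g y -> orderly a ->
  delta <= \sum_(e | A e && (tau e <= lam)) cap e ->
  (forall p, a p <= p.1 + B) -> forall p, y p <= p.1 + (B + lam).
Proof.
move=> st gr oa hC ha p.
have [n] := ubnP (p.1 * delta + p.2); elim: n p => // n IH p pn.
rewrite leqNgt; apply/negP => yp; set u := p.1 + (B + lam).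
have full e : A e && (tau e <= lam) -> cap e <= load a y g p e u.
  case/andP => Ae te; rewrite leqNgt; apply/negP => ld.
  have := gr p e Ae; rewrite leqNgt; apply/negP; rewrite negbK.
  apply: leq_ltn_trans yp; rewrite exit_leq ld andbT /u.
  by rewrite addnA leq_add.
have := leq_trans hC (leq_sum _ full).
rewrite /load (eq_bigr (fun e => cnt (a p)
  (fun q => (before a q p && (u <= y q)) && (g q == e)))); last first.
  move=> e _; apply: eq_cnt => q.
  by rewrite -andbA [X in _ = _ && (_ && X)]andbC.
rewrite cnt_partition leqNgt => /negP; apply.
apply: (@cnt_lt_gen _ p) => q /andP[/andP[bq uy] _].
have qp := orderly_before oa bq; split; last first.
  by apply: contraTneq qp => ->; rewrite prior_irr.
have := prior_gen qp; rewrite leq_eqVlt => /orP[/eqP //|tq].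
have : y q <= q.1 + (B + lam).
  apply: IH; rewrite -ltnS; apply: leq_trans pn; rewrite ltnS.
  have : q.1.+1 * delta <= p.1 * delta by rewrite leq_mul2r tq orbT.
  by rewrite mulSn; have := ltn_ord q.2; lia.
by move: uy; rewrite /u; lia.
Qed.

(* Once somebody of a generation [t >= T0] is driven to a slow edge
   ([lam <= tau]), the fast edges are busy up to stage [t + B + lam]; then the
   whole next generation is late, and as it does not fit on the fast edges it
   again sends somebody to a slow edge. *)
Lemma greedy_steady (A : pred E) a g y B lam T0 : (forall q, q.1 < a q) ->
  step a g y -> (forall p, A (g p)) -> orderly a ->
  \sum_(e | A e && (tau e < lam)) cap e < delta ->
  (forall p, T0 <= p.1 -> a p = p.1 + B) ->
  (forall p, y p <= p.1 + (B + lam)) ->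
  (forall p e, A e -> tau e < lam -> lam <= tau (g p) ->
     y p < exit a y g p e) ->
  exists T1, forall p, T1 <= p.1 -> y p = p.1 + (B + lam).
Proof.
move=> va st Ag oa; set F := fun e => A e && (tau e < lam).
set C := \sum_(e | _) _ => hC ha yle fp.
have fastE q : ~~ (lam <= tau (g q)) -> F (g q) by rewrite /F Ag -ltnNge.
have [p0 p0T p0s] : exists2 p0, T0 <= p0.1 & lam <= tau (g p0).
  apply: contrapT => hn.
  have fast q : T0 <= q.1 -> F (g q).
    by move=> qT; apply: fastE; apply/negP => s; apply: hn; exists q.
  (* On fast edges only, [K] generations would leave through a capacity [C < delta] within
     [T0 + K + (B + lam)] stages; for this [K], [K * C.+1] exceeds [C] times that number. *)
  pose K := C * (T0 + (B + lam)) + 1.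
  have : K * delta <= C * (T0 + K + (B + lam)).
    apply: leq_trans (cnt_late delta T0 K) _.
    apply: (@leq_trans (cnt (T0 + K)
      (fun q => (y q < T0 + K + (B + lam)) && F (g q)))).
      apply: cnt_leq => q qK qT; rewrite qK fast // andbT /=.
      by have := yle q; lia.
    rewrite -cnt_partition /C big_distrl; apply: leq_sum => e _ /=.
    apply: leq_trans (exit_rate_leq (T0 + K) e (T0 + K + (B + lam)) va st).
    by apply: cnt_leq => q -> /=; rewrite andbC.
  have : K * C.+1 <= K * delta by rewrite leq_mul2l hC orbT.
  by rewrite /K; nia.
have next t : T0 <= t -> (exists2 p, p.1 = t & lam <= tau (g p)) ->
    (forall p, p.1 = t.+1 -> y p = p.1 + (B + lam)) /\
    exists2 p, p.1 = t.+1 & lam <= tau (g p).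
  move=> tT [p pt ps].
  have late r : r.1 = t.+1 -> y r = r.1 + (B + lam).
    move=> rt; apply/eqP; rewrite eqn_leq yle /=.
    have ar : a r = r.1 + B by apply: ha; rewrite rt ltnW.
    have [rs|/fastE/andP[Ae te]] := boolP (lam <= tau (g r)).
      by have := step_ge r st; lia.
    have pr : prior p r by rewrite gen_prior // pt rt.
    (* [p] leaves her slow edge at stage [t + (B + lam)] or later, and the edge of [r] would have
       been strictly worse for her. So it is still full at that stage, also for [r], who queues
       behind [p]. *)
    have ep := fp p _ Ae te ps; have yp := step_ge p st.
    have ap : a p = p.1 + B by apply: ha; rewrite pt.
    rewrite leqNgt; apply/negP => yr.
    have : y r <= t + (B + lam) by lia.
    rewrite st exit_leq => /andP[_].
    rewrite ltnNge => /negP; apply.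
    apply: leq_trans (load_orderly _ _ _ _ (oa _ _ pr) pr).
    rewrite leqNgt; apply/negP => ld.
    have : exit a y g p (g r) <= t + (B + lam).
      by rewrite exit_leq ld andbT; lia.
    lia.
  split=> //; apply: contrapT => hn.
  have fast q : q.1 = t.+1 -> F (g q).
    by move=> qT; apply: fastE; apply/negP => s; apply: hn; exists q.
  suff : delta <= C by rewrite leqNgt hC.
  have := cnt_late delta t.+1 1; rewrite mul1n => /leq_trans; apply.
  apply: (@leq_trans (cnt t.+2
    (fun q => (y q == t.+1 + (B + lam)) && F (g q)))).
    apply: cnt_leq => q; rewrite addn1 => qt tq.
    have qE : q.1 = t.+1 by lia.
    by rewrite qt fast // late // qE eqxx.
  rewrite -cnt_partition /C; apply: leq_sum => e _ /=.
  apply: leq_trans (exit_rate t.+2 e (t.+1 + (B + lam)) va st).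
  by apply: cnt_leq => q -> /=; rewrite andbC.
exists p0.1.+1 => p pt.
have all k : (forall q, q.1 = p0.1 + k.+1 -> y q = q.1 + (B + lam)) /\
    exists2 q, q.1 = p0.1 + k.+1 & lam <= tau (g q).
  elim: k => [|k [_ IH]]; first by rewrite addn1; apply: next => //; exists p0.
  by rewrite [p0.1 + _]addnS; apply: next => //; lia.
by have [h _] := all (p.1 - p0.1.+1); apply: h; lia.
Qed.

End Greedy.

(** * Layered networks *)

(** An abstract view of chains of parallel modules. A single module is the case [n = 1], so one
    computation serves both sides of the theorem. *)
Record layered (M : network) (n : nat) (lev : edge M -> nat)
    (node : nat -> vertex M) : Prop := Layered {
  layered_lt : forall e, lev e < n;
  layered_tail : forall e, etail e = node (lev e);
  layered_head : forall e, ehead e = node (lev e).+1;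
  layered_src : node 0 = src M;
  layered_dst : node n = dst M;
  layered_inj : {in [pred k | k <= n] &, injective node}
}.

Section Layered.
Variables (M : network) (n : nat).
Variables (lev : edge M -> nat) (node : nat -> vertex M).
Hypothesis layM : layered n lev node.
Variables (delta : nat) (e0 : edge M).
Implicit Types (p q : player delta) (e : edge M) (sigma : profile M delta).

Local Notation exit := (exit (@tau M) (@net_cap_gt0 M)).
Local Notation step := (step (@tau M) (@net_cap_gt0 M)).

Lemma is_routeE (r : seq (edge M)) : is_route r = (map lev r == iota 0 n).
Proof.
rewrite /is_route -(layered_src layM) -(layered_dst layM).
suff h k : k <= n -> walk (@etail M) (@ehead M) (node k) (node n) r =
    (map lev r == iota k (n - k)) by rewrite h // subn0.
elim: r k => [|e r IH] k kn /=.
  rewrite (inj_in_eq (layered_inj layM)) ?inE ?leqnn //.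
  have [->|kn'] := eqVneq k n; first by rewrite subnn.
  by have -> : n - k = (n - k).-1.+1 by lia.
have en := layered_lt layM e.
rewrite (layered_tail layM) (inj_in_eq (layered_inj layM)) ?inE // 1?ltnW //.
have [<-|ek] := eqVneq (lev e) k.
  by rewrite (layered_head layM) IH // -(subnSK en) /= eqseq_cons !eqxx.
by case: (n - k) => //= m; rewrite eqseq_cons (negPf ek).
Qed.

Lemma route_size (r : route M) : size (sval r) = n.
Proof.
have := svalP r; rewrite is_routeE => /eqP /(congr1 size).
by rewrite size_map size_iota.
Qed.

Lemma route_lev (r : route M) k : k < n -> lev (nth e0 (sval r) k) = k.
Proof.
move=> kn; rewrite -(nth_map _ 0) ?route_size //.
by have := svalP r; rewrite is_routeE => /eqP ->; rewrite nth_iota.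
Qed.

Lemma is_routeP (r : seq (edge M)) : size r = n ->
  (forall k, k < n -> lev (nth e0 r k) = k) -> is_route r.
Proof.
move=> rn rl; rewrite is_routeE; apply/eqP/(@eq_from_nth _ 0).
  by rewrite size_map size_iota.
rewrite size_map rn => k kn.
by rewrite (nth_map e0) ?rn // rl // nth_iota.
Qed.

Lemma route_verticesE (r : route M) :
  route_vertices (sval r) = map node (iota 0 n.+1).
Proof.
rewrite /route_vertices /walk_vertices /= -(layered_src layM); congr (_ :: _).
have := svalP r; rewrite is_routeE => /eqP rE.
rewrite (iotaDl 1 0) -rE -!map_comp; apply: eq_map => e /=.
by rewrite (layered_head layM) add1n.
Qed.

Lemma index_node (r : route M) k : k <= n ->
  index (node k) (route_vertices (sval r)) = k.
Proof.
move=> kn; rewrite route_verticesE.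
have kE : node k = nth (node 0) (map node (iota 0 n.+1)) k.
  by rewrite (nth_map 0) ?size_iota ?ltnS // nth_iota.
rewrite kE index_uniq ?size_map ?size_iota ?ltnS //.
rewrite map_inj_in_uniq ?iota_uniq // => i j; rewrite !mem_iota => ? ?.
by apply: (layered_inj layM); rewrite inE; lia.
Qed.

Definition choice_at sigma k : player delta -> edge M :=
  fun p => nth e0 (edges_of sigma p) k.

Lemma onth_edges sigma p k e : (onth (edges_of sigma p) k == Some e) =
  (k < n) && (choice_at sigma k p == e).
Proof.
have rn := route_size (sigma p); rewrite /choice_at /edges_of.
case: ltnP => kn; last by rewrite onth_default ?rn.
by rewrite onthE (nth_map e0) ?rn // (inj_eq Some_inj).
Qed.

(** Only position [lev e] of a route can hold [e], and whoever is ahead of [p] on [e] has reached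
    the head when [p] has. *)
Lemma num_aheadE sigma (x : timing delta) e u p k :
  (forall q j, j <= n -> q.1 < x q j) -> lev e = k ->
  x p k + tau e <= u ->
  num_ahead sigma x e u p k = load (x^~ k) (x^~ k.+1) (choice_at sigma k) p e u.
Proof.
move=> vx ek pu; have kn : k < n by rewrite -ek (layered_lt layM).
transitivity (cnt u (fun q => queued sigma x e u q k && ahead x q k p k)).
  apply: eq_bigr => s _; apply: eq_bigr => i _.
  have kz : k < size (edges_of sigma (s : nat, i)) by rewrite route_size.
  rewrite (bigD1 (Ordinal kz)) //= big1 ?addn0 // => j jk.
  rewrite /queued onth_edges; case: ltnP => //= jn.
  case: eqP => // je; case/eqP: jk; apply: val_inj => /=.
  by rewrite -ek -je /choice_at route_lev.
apply: eq_cnt => q; rewrite /queued onth_edges kn /=.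
have -> : ahead x q k p k = before (x^~ k) q p by [].
case bq: (before _ q p); rewrite ?andbF //=.
have := before_entry bq; have := vx q k (ltnW kn).
case: (_ == e) => /=; rewrite ?andbF ?andbT //=; lia.
Qed.

Definition follows sigma (x : timing delta) : Prop :=
  (forall p, x p 0 = departure p) /\
  forall k, k < n -> step (x^~ k) (choice_at sigma k) (x^~ k.+1).

Lemma follows_valid sigma x : follows sigma x ->
  forall q j, j <= n -> q.1 < x q j.
Proof.
move=> [x0 xs] q; elim=> [|j IH] jn; first by rewrite x0.
by have := step_ge q (xs j jn); have := IH (ltnW jn); lia.
Qed.

(** The game constrains every stage spent in a queue, while [exit] picks the first stage with room;
    [exit_leq] reconciles the two. *)
Lemma is_timingE sigma x : is_timing sigma x <-> follows sigma x.
Proof.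
split=> [xt|xf].
  have vx : forall q j, j <= n -> q.1 < x q j.
    move=> q; have [x0 xs] := xt q; elim=> [|j IH] jn; first by rewrite x0.
    have [] := xs j (choice_at sigma j q); last by have := IH (ltnW jn); lia.
    by apply/eqP; rewrite onth_edges jn /=.
  split=> [p|k kn p]; first by case: (xt p).
  have [_ /(_ k (choice_at sigma k p))[]] := xt p.
    by apply/eqP; rewrite onth_edges kn /=.
  set e := choice_at sigma k p; move=> le q.
  have ek : lev e = k by apply: route_lev.
  have qE u : x p k + tau e <= u -> u <= x p k.+1 ->
      (x p k.+1 == u) =
      (load (x^~ k) (x^~ k.+1) (choice_at sigma k) p e u < cap e).
    move=> u1 u2; rewrite -num_aheadE // q // /queued onth_edges kn eqxx.
    by rewrite u1 u2.
  have ex : exit (x^~ k) (x^~ k.+1) (choice_at sigma k) p e <= x p k.+1.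
    by rewrite exit_leq le -qE ?eqxx.
  have := leqnn (exit (x^~ k) (x^~ k.+1) (choice_at sigma k) p e).
  by rewrite exit_leq => /andP[h1 h2]; apply/eqP; rewrite qE.
have vx := follows_valid xf; have [x0 xs] := xf.
move=> p; split=> // k e /eqP; rewrite onth_edges => /andP[kn /eqP ge].
have xk := xs k kn p; rewrite /= ge in xk.
have ek : lev e = k by rewrite -ge; apply: route_lev.
have le : x p k + tau e <= x p k.+1 by rewrite xk exit_ge.
split=> // u /and3P[_ u1 u2]; rewrite num_aheadE //.
by rewrite eqn_leq u2 andbT [in LHS]xk exit_leq u1.
Qed.

(** The exits of one level are the entries of the next. [L] stays abstract to cover both the timing
    of a given profile and the construction of the worst equilibrium. *)
Lemma levels_ex (L : nat -> (player delta -> nat) -> (player delta -> edge M) ->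
      (player delta -> nat) -> Prop) :
  (forall k a, k < n -> (forall q, q.1 < a q) ->
     exists g y, L k a g y /\ forall q, q.1 < y q) ->
  exists (g : nat -> player delta -> edge M) (x : timing delta),
    (forall p, x p 0 = departure p) /\
    forall k, k < n -> L k (x^~ k) (g k) (x^~ k.+1).
Proof.
move=> hL.
have [F hF] : {F : nat * (player delta -> nat) ->
      (player delta -> edge M) * (player delta -> nat) &
    forall ka, ka.1 < n -> (forall q, q.1 < ka.2 q) ->
      L ka.1 ka.2 (F ka).1 (F ka).2 /\ forall q, q.1 < (F ka).2 q}.
  apply: (@choice _ _ (fun ka gy => ka.1 < n -> (forall q, q.1 < ka.2 q) ->
    L ka.1 ka.2 gy.1 gy.2 /\ forall q, q.1 < gy.2 q)) => -[k a] /=.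
  have [kn|kn] := ltnP k n; last by exists ((fun=> e0), a).
  have [va|va] := pselect (forall q, q.1 < a q); last by exists ((fun=> e0), a).
  by have [g [y h]] := hL k a kn va; exists (g, y).
pose X := fix X k := if k is k'.+1 then (F (k', X k')).2 else @departure delta.
exists (fun k => (F (k, X k)).1), (fun p k => X k p); split=> // k kn.
have vX j : j <= n -> forall q, q.1 < X j q.
  elim: j => [_ q //|j IH jn]; by have [] := hF (j, X j) jn (IH (ltnW jn)).
by have [] := hF (k, X k) kn (vX k (ltnW kn)).
Qed.

Lemma follows_ex sigma : exists x, follows sigma x.
Proof.
have [|g [x [x0 xs]]] := @levels_ex (fun k a g y =>
    g = choice_at sigma k /\ step a g y).
  move=> k a kn va; exists (choice_at sigma k).
  have [y hy] := step_ex (@tau M) (@net_cap_gt0 M) (choice_at sigma k) va.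
  by exists y; split=> //; apply: step_valid hy.
by exists x; split=> // k kn; have [<-] := xs k kn.
Qed.

(** With [k = n] this gives uniqueness of the timing; with smaller [k], that a deviation at level
    [k] does not affect arrivals at [node k]. *)
Lemma follows_agree sigma sigma' x x' k : k <= n ->
  follows sigma x -> follows sigma' x' ->
  (forall j, j < k -> choice_at sigma j =1 choice_at sigma' j) ->
  forall j, j <= k -> x^~ j = x'^~ j.
Proof.
move=> kn xf xf' hg; elim=> [_|j IH jk].
  by apply/funext => p; rewrite xf.1 xf'.1.
have jn : j < n by apply: leq_trans kn.
have st := xf.2 _ jn; have st' := xf'.2 _ jn.
have xx := IH (ltnW jk); apply/funext => p.
apply: (step_agree (S := predT) _ st st') => // [q|q _|q r _].
- exact: (follows_valid xf q (ltnW jn)).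
- by split; [rewrite -[LHS]/((x^~ j) q) xx|apply: hg].
- by rewrite xx.
Qed.

Lemma outcome_follows sigma : follows sigma (outcome sigma).
Proof.
apply/is_timingE; rewrite /outcome; case: xgetP => // xN.
have [x /is_timingE xt] := follows_ex sigma.
by case: (xN x).
Qed.

Lemma outcomeE sigma x p k : follows sigma x -> k <= n ->
  outcome sigma p k = x p k.
Proof.
move=> xf kn.
have := follows_agree (leqnn n) (outcome_follows sigma) xf
  (fun _ _ _ => erefl) kn.
by move/(congr1 (fun f => f p)).
Qed.

(** Cost and wait on the [k]-th edge add up to [x p k.+1 - x p k], and the sum telescopes. *)
Lemma latencyE sigma p : latency sigma p + departure p = outcome sigma p n.
Proof.
have [x0 xs] := outcome_follows sigma.
rewrite /latency /transit_cost /waiting_time.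
set x := outcome sigma in x0 xs *; set r := edges_of sigma p.
have rn : size r = n by apply: route_size.
rewrite big_tnth -big_split /=.
rewrite (eq_bigr (fun k : 'I_(size r) => x p k.+1 - x p k)).
  rewrite rn -x0 -(big_mkord xpredT (fun k => x p k.+1 - x p k)).
  rewrite telescope_sumn_in //.
    rewrite subnK //; have : forall j, j <= n -> x p 0 <= x p j; last exact.
    elim=> // j IH jn; apply: leq_trans (IH (ltnW jn)) _.
    by have := step_ge p (xs j jn) => /=; lia.
  by move=> i /andP[_ jn]; have := step_ge p (xs i jn) => /=; lia.
move=> k _; have kn : k < n by rewrite -rn.
have := step_ge p (xs k kn); rewrite (tnth_nth e0) /= /choice_at -/r; lia.
Qed.

Lemma arrivalE sigma p k : k <= n ->
  arrival sigma p (node k) = outcome sigma p k.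
Proof. by move=> kn; rewrite /arrival index_node. Qed.

(** The Nash condition is the case [k = n], by [latencyE]. *)
Lemma ufrE sigma : ufr sigma <-> forall p (r : route M) k, k <= n ->
  outcome sigma p k <= outcome (deviate sigma p r) p k.
Proof.
split=> [[_ h] p r k kn|h].
  rewrite -!arrivalE //; apply: h; rewrite route_verticesE map_f //.
    by rewrite mem_iota add0n ltnS.
  by rewrite mem_iota add0n ltnS.
split=> [p r|p v]; first by rewrite -(leq_add2r (departure p)) !latencyE h.
rewrite route_verticesE => /mapP[k].
rewrite mem_iota add0n ltnS => /andP[_ kn] ->.
by move=> r _; rewrite !arrivalE // h.
Qed.

Definition locally_greedy sigma (x : timing delta) : Prop :=
  forall k, k < n ->
  greedy (@tau M) (@net_cap_gt0 M) (fun e => lev e == k)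
    (x^~ k) (choice_at sigma k) (x^~ k.+1).

(** Deviating only on the edge of level [k] changes neither the entries into that level nor the
    exits of those queued before [p], so her new exit is the one that [greedy] refers to. *)
Lemma ufr_greedy sigma : ufr sigma -> locally_greedy sigma (outcome sigma).
Proof.
move=> /ufrE hu k kn p e /eqP ek.
have xf := outcome_follows sigma; set x := outcome sigma in xf *.
have rP : is_route (set_nth e0 (edges_of sigma p) k e).
  apply: is_routeP => [|j jn].
    by rewrite size_set_nth route_size; apply/maxn_idPr.
  rewrite nth_set_nth /=; case: eqP => [->//|_]; exact: route_lev.
pose r : route M := exist (fun r => is_route r) _ rP.
have := hu p r k.+1 kn; rewrite -/x => /leq_trans; apply.
have xf' := outcome_follows (deviate sigma p r).
set sigma' := deviate sigma p r in xf' *; set x' := outcome sigma' in xf' *.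
have cE j q : choice_at sigma' j q =
    if (q == p) && (j == k) then e else choice_at sigma j q.
  rewrite /choice_at /edges_of /sigma' /deviate; case: (q =P p) => //= ->.
  by rewrite nth_set_nth.
have xx : x^~ k = x'^~ k.
  apply: (follows_agree (ltnW kn) xf xf') => // j jk q.
  by rewrite cE (ltn_eqF jk) andbF.
have va q : q.1 < x q k by apply: (follows_valid xf q (ltnW kn)).
have yy q : before (x^~ k) q p -> x q k.+1 = x' q k.+1.
  apply: (step_agree (S := fun q => before (x^~ k) q p) va
    (xf.2 k kn) (xf'.2 k kn)).
  - move=> q1 b1; rewrite -[x' q1 k]/((x'^~ k) q1) -xx cE.
    by case: eqP b1 => // ->; rewrite before_irr.
  - by move=> q1 q2 _; rewrite xx.
  - by move=> q1 q2 b1 b2; apply: before_trans b1.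
have -> : x' p k.+1 = exit (x'^~ k) (x'^~ k.+1) (choice_at sigma' k) p e.
  by rewrite (xf'.2 k kn p) /= cE !eqxx.
rewrite -xx.
suff -> : exit (x^~ k) (x^~ k.+1) (choice_at sigma k) p e =
  exit (x^~ k) (x'^~ k.+1) (choice_at sigma' k) p e by [].
apply: exit_congr => // q bq _; split; last exact: yy.
by rewrite cE; case: eqP bq => // ->; rewrite before_irr.
Qed.

Lemma greedy_levels_orderly sigma x :
  follows sigma x -> locally_greedy sigma x ->
  forall k, k <= n -> orderly (x^~ k).
Proof.
move=> xf xg; elim=> [_ p q /prior_gen|k IH kn]; first by rewrite !xf.1.
apply: greedy_orderly (xg k kn) (IH (ltnW kn)); first exact: xf.2 kn.
by move=> p; rewrite /choice_at route_lev.
Qed.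

(* Whatever [p] does, those prior to her are not affected, and neither she nor
   anybody after her reaches [node k] before she does in a greedy profile. *)
Lemma greedy_ufr sigma : locally_greedy sigma (outcome sigma) -> ufr sigma.
Proof.
move=> xg; apply/ufrE => p r.
have xf := outcome_follows sigma.
have xf' := outcome_follows (deviate sigma p r).
set x := outcome sigma in xf xg *; set sigma' := deviate sigma p r in xf' *.
set x' := outcome sigma' in xf' *.
have xo := greedy_levels_orderly xf xg.
suff h k : k <= n -> (forall q, prior q p -> x q k = x' q k) /\
    (forall q, ~~ prior q p -> x p k <= x' q k).
  by move=> k kn; apply: (h k kn).2; rewrite prior_irr.
elim: k => [_|k IH kn].
  split=> q; rewrite xf.1 xf'.1 //.
  by apply: contraR => pq; apply: gen_prior; rewrite -ltnS ltnNge.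
have [eqx lex] := IH (ltnW kn).
have va q : q.1 < x q k by apply: (follows_valid xf q (ltnW kn)).
have cE q : q != p -> choice_at sigma' k q = choice_at sigma k q.
  by rewrite /choice_at /edges_of /sigma' /deviate => /negPf ->.
have priorN q : prior q p -> q != p.
  by apply: contraTneq => ->; rewrite prior_irr.
have yy q : prior q p -> x q k.+1 = x' q k.+1.
  apply: (step_agree (S := fun q => prior q p) va
    (xf.2 k kn) (xf'.2 k kn)).
  - by move=> q1 q1p; rewrite cE ?priorN // eqx.
  (* If [q2] is not prior to [p], she is behind [q1] in both profiles: she enters no earlier and
     loses ties. *)
  - move=> q1 q2 q1p; rewrite /before -(eqx q1) //.
    have [q2p|q2p] := boolP (prior q2 p); first by rewrite -eqx.
    have q12 : prior q1 q2.
      case/or3P: (prior_total q1 q2) => // [q21|/eqP q12].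
        by rewrite (prior_trans q21 q1p) in q2p.
      by rewrite -q12 q1p in q2p.
    have := xo k (ltnW kn) q1 q2 q12; have := xo k (ltnW kn) q1 p q1p.
    by rewrite (prior_asym q12) !andbF !orbF; have := lex q2 q2p => /=; lia.
  - move=> q1 q2 q1p /(orderly_before (xo k (ltnW kn))) q21.
    exact: prior_trans q1p.
split=> // q qp.
have lq : lev (choice_at sigma' k q) == k by rewrite /choice_at route_lev.
(* In the greedy profile [p] could use the edge that [q] uses after the deviation; those ahead of
   [p] there are prior to her, unaffected, and hence ahead of [q] too. *)
apply: leq_trans (xg k kn p _ lq) _; rewrite [x' q k.+1](xf'.2 k kn q).
apply: leq_exit; first exact: lex.
move=> v s bs gs vs.
have sp := orderly_before (xo k (ltnW kn)) bs.
rewrite -yy // vs cE ?priorN // gs !andbT.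
have s_q : prior s q.
  case/or3P: (prior_total s q) => // [qs|/eqP sq].
    by rewrite (prior_trans qs sp) in qp.
  by rewrite -sq sp in qp.
have := lex q qp; have := before_entry bs; have := va s.
rewrite /before s_q -(eqx s) //= andbT; lia.
Qed.

End Layered.

(** * Latencies in layered networks *)

Lemma sum_leqn m t : \sum_(l < m) (t <= l) = m - t.
Proof. by elim: m => [|m IH]; rewrite ?big_ord0 // big_ord_recr /= IH; lia. Qed.

Lemma sum_ltn m t : \sum_(l < m) (l < t) = minn m t.
Proof.
by elim: m => [|m IH]; rewrite ?big_ord0 ?min0n // big_ord_recr /= IH; lia.
Qed.

Lemma sum_eqn m t : \sum_(l < m) (l == t :> nat) = (t < m).
Proof. by elim: m => [|m IH]; rewrite ?big_ord0 // big_ord_recr /= IH; lia. Qed.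

(** As [a] is downward closed, the elements satisfying it form a prefix of the sorted sequence. *)
Lemma count_take_sorted (T : Type) (leT : rel T) (a : pred T) m (s : seq T) :
  transitive leT -> (forall x y, leT x y -> a y -> a x) -> sorted leT s ->
  count a (take m s) = minn m (count a s).
Proof.
move=> tr da; elim: s m => [|x s IH] [|m] //=; rewrite ?min0n ?minn0 // => ps.
rewrite IH ?(path_sorted ps) //.
case ax: (a x); first by rewrite !add1n minnSS.
suff -> : count a s = 0 by rewrite !minn0.
apply/eqP; rewrite -leqn0 leqNgt -has_count; apply/negP => ha.
have := order_path_min tr ps; elim: s ha {IH ps} => //= y s IH.
case/orP => [ay /andP[xy _]|hs /andP[_]]; last exact: IH.
by rewrite (da x y) in ax.
Qed.

(** * Cheapest assignment of one generation to one module *)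

Section Assignment.
Variables (E : finType) (tau cap : E -> nat) (A : pred E).

Definition captau l : nat := \sum_(e | A e && (tau e <= l)) cap e.

(* Fill the edges by increasing transit cost, each one up to its capacity. *)
Lemma cheapest_assignment delta lam :
  delta <= captau lam -> (forall l, l < lam -> captau l < delta) ->
  exists c : 'I_delta -> E, [/\ forall i, A (c i),
    forall e, \sum_(i < delta) (c i == e) <= cap e &
    \sum_(i < delta) tau (c i) = \sum_(l < lam) (delta - captau l)].
Proof.
move=> hlam hl.
pose B e := A e && (tau e <= lam).
(* Each edge is listed as often as its capacity; the players get the first [delta] entries after
   sorting by cost. *)
pose w := flatten [seq nseq (cap e) e | e <- enum B].
pose le := relpre tau leq; pose W := sort le w.
have le_tr : transitive le by move=> x y z; apply: leq_trans.
have le_tot : total le by move=> x y; apply: leq_total.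
have cW a : count a W = \sum_(e | B e) cap e * a e.
  rewrite /W (permP (permEl (perm_sort _ _))) /w count_flatten -map_comp.
  rewrite sumnE big_map big_enum; apply: eq_bigr => e _ /=.
  by rewrite count_nseq mulnC.
have Wsz : size W = captau lam.
  by rewrite -count_predT cW; apply: eq_bigr => e _; rewrite muln1.
have WB e : e \in W -> B e.
  rewrite mem_sort => /flatten_mapP[e' He' /nseqP[-> _]].
  by move: He'; rewrite mem_enum.
pose s := take delta W.
have ssz : size s = delta by rewrite size_takel // Wsz.
have sB e : e \in s -> B e by move/mem_take/WB.
have csW a : count a s <= count a W.
  by rewrite -[W in leqRHS](cat_take_drop delta) count_cat leq_addr.
have cs l : l < lam -> count (fun e => tau e <= l) s = captau l.
  move=> ll; rewrite (count_take_sorted _ le_tr) ?sort_sorted //; last first.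
    by move=> x y xy /(leq_trans xy).
  rewrite cW (_ : \sum_(e | B e) _ = captau l).
    by apply/minn_idPr/ltnW/hl.
  rewrite /captau [RHS]big_mkcond [LHS]big_mkcond; apply: eq_bigr => e _.
  rewrite /B; case: (A e) => //=.
  by case: (leqP (tau e) l); case: (leqP (tau e) lam) => //=; lia.
case: (posnP delta) => [d0|d0].
  have F (i : 'I_delta) : False by have := ltn_ord i; rewrite {2}d0.
  exists (fun i => False_rect E (F i)); split=> [i|e|]; first by case: (F i).
    by rewrite big1 // => i; case: (F i).
  rewrite [LHS]big1 => [|i]; last by case: (F i).
  by rewrite big1 // => l _; rewrite d0.
have [e0 _] : exists e0, e0 \in s.
  by case: (s) ssz d0 => [<-//|e0 s' _ _]; exists e0; rewrite mem_head.
have sumE (F : E -> nat) : \sum_(i < delta) F (nth e0 s i) = \sum_(e <- s) F e.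
  by rewrite (big_nth e0) ssz big_mkord.
exists (fun i => nth e0 s i); split=> [i|e|].
- by have /sB/andP[] : nth e0 s i \in s by rewrite mem_nth ?ssz.
- rewrite (sumE (fun e' => e' == e)) -big_mkcond sum1_count.
  apply: leq_trans (csW _) _; rewrite cW.
  have [Be|Be] := boolP (B e).
    rewrite (bigD1 e) //= eqxx muln1 big1 ?addn0 // => e' /andP[_ /negPf ->].
    by rewrite muln0.
  rewrite big1 // => e' Be'; case: eqP => [ee|_]; rewrite ?muln0 //.
  by rewrite -ee Be' in Be.
- rewrite (sumE tau).
  (* Costs are summed by layers: for each [l < lam], all but [captau l] players pay more than
     [l]. *)
  have -> : \sum_(e <- s) tau e = \sum_(e <- s) \sum_(l < lam) (l < tau e).
    rewrite !big_seq; apply: eq_bigr => e /sB/andP[_ te].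
    by rewrite sum_ltn; apply/esym/minn_idPr.
  rewrite exchange_big; apply: eq_bigr => l _ /=.
  rewrite -cs // -{1}ssz -(count_predC (fun e => tau e <= l) s) addKn.
  rewrite -big_mkcond sum1_count; apply: eq_count => e /=.
  by rewrite ltnNge.
Qed.
End Assignment.

Lemma edge_ex (M : network) : exists e : edge M, True.
Proof.
have [r hr _] := net_cover (src M); move: hr; case: r => [|e r] /=.
  by rewrite (negPf (net_src_neq_dst M)).
by move=> _; exists e.
Qed.

(** * Optimal latency and equilibrium bound of a layered network *)

Section Values.
Variables (M : network) (n : nat).
Variables (lev : edge M -> nat) (node : nat -> vertex M).
Hypothesis layM : layered n lev node.
Variables (delta : nat) (lam : nat -> nat).

Definition caplev k := captau (@tau M) (@cap M) (fun e => lev e == k).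

Hypothesis lamP : forall k l, k < n -> (delta <= caplev k l) = (lam k <= l).
Implicit Types (p q : player delta) (e : edge M) (sigma : profile M delta).

Local Notation exit := (exit (@tau M) (@net_cap_gt0 M)).
Local Notation step := (step (@tau M) (@net_cap_gt0 M)).

Definition lamsum k : nat := \sum_(j < k) lam j.
Lemma lamsumS k : lamsum k.+1 = lamsum k + lam k.
Proof. by rewrite /lamsum big_ord_recr. Qed.

(** The cost of the cheapest assignments by layers: [delta - caplev k l] players do not fit on the
    edges of level [k] of cost at most [l]. *)
Definition optval : nat := \sum_(k < n) \sum_(l < lam k) (delta - caplev k l).

Lemma greedy_levels_bound e0 sigma x :
  follows n e0 sigma x -> locally_greedy n lev e0 sigma x ->
  forall k, k <= n -> forall q, x q k <= q.1 + (1 + lamsum k).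
Proof.
move=> xf xg; have xo := greedy_levels_orderly layM xf xg.
elim=> [_ q|k IH kn q].
  by rewrite xf.1 /departure /lamsum big_ord0; lia.
rewrite lamsumS [1 + _]addnA.
apply: (greedy_bound (B := 1 + lamsum k) (lam := lam k) (xf.2 k kn) (xg k kn)
  (xo k (ltnW kn)) _ (IH (ltnW kn))).
by rewrite -/(captau _ _ _ _) -/(caplev k) lamP.
Qed.

Lemma ufr_latency sigma p : ufr sigma -> latency sigma p <= lamsum n.
Proof.
have [e0 _] := edge_ex M; move=> /(ufr_greedy layM e0) xg.
have := greedy_levels_bound (outcome_follows layM e0 sigma) xg (leqnn n) p.
by rewrite -(latencyE layM e0) /departure; lia.
Qed.

(** In level [k] a player pays at least [lam k] minus the number of [l < lam k] that reach the cost
    of her edge. For players of latency at most [L] these [l] are counted against the capacities;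
    the others pay [L] anyway. *)
Lemma optval_lower sigma : exists K, forall T,
  T * optval <= \sum_(t < T) gen_latency sigma t + K.
Proof.
have [e0 _] := edge_ex M.
have xf := outcome_follows layM e0 sigma; set x := outcome sigma in xf.
pose c k p := choice_at e0 sigma k p.
pose L := lamsum n; pose lat := latency sigma.
have latb p : L <= lat p +
    \sum_(k < n) \sum_(l < lam k) ((tau (c k p) <= l) && (lat p <= L)).
  have [lp|/ltnW lp] := leqP (lat p) L; last first.
    by rewrite (leq_trans lp) ?leq_addr.
  apply: (@leq_trans (\sum_(k < n) (tau (c k p) + (lam k - tau (c k p))))).
    by apply: leq_sum => k _; lia.
  rewrite big_split leq_add //=.
    rewrite /lat /latency /transit_cost (big_nth e0) (route_size layM).
    rewrite big_mkord; exact: leq_addr.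
  apply: leq_sum => k _; rewrite -sum_leqn.
  by apply: leq_sum => l _; rewrite andbT.
(* Players of the first [T] generations with latency at most [L] leave before stage [T + (L + 1)];
   the extra [L + 1] stages give the constant. *)
exists (\sum_(k < n) \sum_(l < lam k) caplev k l * (L + 1)) => T.
have sumb : T * delta * L <= \sum_(t < T) gen_latency sigma t +
    \sum_(k < n) \sum_(l < lam k)
      cnt T (fun q => (tau (c k q) <= l) && (lat q <= L)).
  have -> : T * delta * L = \sum_(t < T) \sum_(i < delta) L.
    by rewrite !big_const_ord !iter_addn_0; lia.
  apply: (@leq_trans (\sum_(t < T) \sum_(i < delta) (lat (t : nat, i) +
    \sum_(k < n) \sum_(l < lam k)
      ((tau (c k (t : nat, i)) <= l) && (lat (t : nat, i) <= L))))).
    by apply: leq_sum => t _; apply: leq_sum => i _; apply: latb.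
  rewrite (eq_bigr (fun t : 'I_T => gen_latency sigma t + \sum_(i < delta)
    \sum_(k < n) \sum_(l < lam k)
      ((tau (c k (t : nat, i)) <= l) && (lat (t : nat, i) <= L)))); last first.
    by move=> t _; rewrite big_split.
  rewrite big_split leq_add2l /cnt.
  under eq_bigr do rewrite exchange_big.
  rewrite exchange_big; apply: leq_sum => k _.
  under eq_bigr do rewrite exchange_big.
  by rewrite exchange_big.
have cntb k l : k < n ->
    cnt T (fun q => (tau (c k q) <= l) && (lat q <= L)) <=
    caplev k l * (T + (L + 1)).
  move=> kn; apply: (@leq_trans (cnt T (fun q => (x q k.+1 < T + (L + 1)) &&
      ((lev (c k q) == k) && (tau (c k q) <= l))))).
    apply: cnt_leq => q qT /andP[-> ql].
    rewrite qT (route_lev layM) // eqxx !andbT /=.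
    have mono : forall j, k.+1 + j <= n -> x q k.+1 <= x q (k.+1 + j).
      elim=> [|j IH]; rewrite ?addn0 // addnS => jn.
      apply: leq_trans (IH (ltnW jn)) _.
      by have := step_ge q (xf.2 _ jn) => /=; lia.
    have := mono (n - k.+1); rewrite subnKC // => /(_ (leqnn n)).
    have := latencyE layM e0 sigma q; rewrite -/(lat q) -/x /departure; lia.
  apply: leq_trans (eq_leq (esym (cnt_partition
    (fun e => (lev e == k) && (tau e <= l)) (c k) T
    (fun q => x q k.+1 < T + (L + 1))))) _.
  rewrite /caplev /captau big_distrl; apply: leq_sum => e _ /=.
  apply: leq_trans (exit_rate_leq T e (T + (L + 1))
    (fun q => follows_valid xf q (ltnW kn)) (xf.2 k kn)).
  by apply: cnt_leq => q -> /=; rewrite andbC.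
have sumc : T * delta * L <= \sum_(t < T) gen_latency sigma t +
    \sum_(k < n) \sum_(l < lam k) caplev k l * (T + (L + 1)).
  apply: leq_trans sumb _; rewrite leq_add2l.
  by apply: leq_sum => k _; apply: leq_sum => l _; apply: cntb.
have split1 : \sum_(k < n) \sum_(l < lam k) caplev k l * (T + (L + 1)) =
    \sum_(k < n) \sum_(l < lam k) caplev k l * T +
    \sum_(k < n) \sum_(l < lam k) caplev k l * (L + 1).
  rewrite -big_split; apply: eq_bigr => k _; rewrite -big_split.
  by apply: eq_bigr => l _; rewrite mulnDr.
have split2 : T * delta * L = T * optval +
    \sum_(k < n) \sum_(l < lam k) caplev k l * T.
  rewrite /L /lamsum /optval !big_distrr -big_split; apply: eq_bigr => k _ /=.
  have -> : T * delta * lam k = \sum_(l < lam k) T * delta.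
    by rewrite big_const_ord iter_addn_0.
  rewrite big_distrr -big_split; apply: eq_bigr => l _ /=.
  have := lamP l (ltn_ord k); rewrite [lam k <= l]leqNgt ltn_ord => /negbT.
  rewrite -ltnNge mulnBr => /ltnW cd.
  by rewrite [_ * T]mulnC subnK // leq_mul2l cd orbT.
by move: sumc; rewrite split1 split2 addnA; lia.
Qed.

Lemma profile_of (c : nat -> player delta -> edge M) e0 :
  (forall k p, k < n -> lev (c k p) = k) ->
  exists sigma, forall k, k < n -> choice_at e0 sigma k = c k.
Proof.
move=> hc.
have rP p : is_route (mkseq (fun k => c k p) n).
  apply: (is_routeP layM (e0 := e0)); first by rewrite size_mkseq.
  by move=> k kn; rewrite nth_mkseq // hc.
exists (fun p => exist (fun r => is_route r) _ (rP p)) => k kn.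
by apply/funext => p; rewrite /choice_at /edges_of /= nth_mkseq.
Qed.

(* At most one generation of each index [i] enters an edge at a given stage. *)
Lemma uniform_step (c : 'I_delta -> edge M) (b : 'I_delta -> nat) :
  (forall e, \sum_(i < delta) (c i == e) <= cap e) ->
  step (fun q => q.1.+1 + b q.2) (fun q => c q.2)
       (fun q => q.1.+1 + b q.2 + tau (c q.2)).
Proof.
move=> hc p; apply/eqP; rewrite eqn_leq exit_ge /= exit_leq leqnn /=.
set e := c p.2; apply: leq_trans (hc e).
rewrite [leqRHS](bigD1 p.2) //= eqxx add1n ltnS /load /cnt exchange_big.
rewrite [leqRHS]big_mkcond; apply: leq_sum => i _ /=.
(* A player of index [i] on [e] counts only if she entered it at the same stage as [p], which fixes
   her generation; for [i = p.2] she would be [p] herself. *)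
apply: (@leq_trans (\sum_(s < p.1.+1 + b p.2)
    ((i != p.2) && (c i == e)) * (s == p.1 + b p.2 - b i :> nat))).
  apply: leq_sum => s _; case: (c i =P e) => [ce|_]; last first.
    rewrite /=. by rewrite andbF.
  rewrite ce andbT /before /prior /=; case: (i =P p.2) => [->|_] /=.
    lia.
  by rewrite mul1n; lia.
rewrite -big_distrr /= sum_eqn.
by case: (i == _) => //=; case: (c i == e) => //=; rewrite ?mul1n ?leq_b1.
Qed.

Lemma optval_upper : exists sigma : profile M delta,
  forall t, gen_latency sigma t = optval.
Proof.
have [e0 _] := edge_ex M.
pose Q k (c : 'I_delta -> edge M) := [/\ forall i, lev (c i) = k,
    forall e, \sum_(i < delta) (c i == e) <= cap e &
    \sum_(i < delta) tau (c i) = \sum_(l < lam k) (delta - caplev k l)].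
have [c hc] : {c : nat -> 'I_delta -> edge M & forall k, k < n -> Q k (c k)}.
  apply: (@choice _ _ (fun k c => k < n -> Q k c)) => k.
  have [kn|kn] := ltnP k n; last by exists (fun=> e0).
  have [||c [c1 c2 c3]] := @cheapest_assignment _ (@tau M) (@cap M)
      (fun e => lev e == k) delta (lam k).
  - by rewrite -/(caplev k) lamP.
  - by move=> l lk; rewrite ltnNge -/(caplev k) lamP // -ltnNge.
  by exists c => _; split=> // i; apply/eqP.
have [sigma hs] := @profile_of (fun k p => c k p.2) e0
  (fun k p kn => let: And3 h _ _ := hc k kn in h p.2).
pose x : timing delta := fun p k => p.1.+1 + \sum_(j < k) tau (c j p.2).
have xf : follows n e0 sigma x.
  split=> [p|k kn]; first by rewrite /x big_ord0 addn0.
  have [_ c2 _] := hc k kn; rewrite hs //.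
  have -> : x^~ k.+1 =
      fun q => q.1.+1 + \sum_(j < k) tau (c j q.2) + tau (c k q.2).
    by apply/funext => q; rewrite /x big_ord_recr addnA.
  exact: (uniform_step (fun i => \sum_(j < k) tau (c j i)) c2).
exists sigma => t; rewrite /gen_latency.
transitivity (\sum_(i < delta) \sum_(k < n) tau (c k i)).
  apply: eq_bigr => i _; apply/eqP; rewrite -(eqn_add2r (departure (t, i))).
  rewrite (latencyE layM e0) (outcomeE layM _ xf) // /x addnC.
  by [].
rewrite exchange_big; apply: eq_bigr => k _.
by have [_ _ ->] := hc k (ltn_ord k).
Qed.

(** * The worst equilibrium *)

Hypothesis delta_gt0 : 0 < delta.

Lemma level_edge k : k < n -> exists e, lev e = k.
Proof.
move=> kn; apply: contrapT => h; have := lamP (lam k) kn.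
rewrite leqnn leqNgt => /negP; apply.
rewrite /caplev /captau big1 // => e /andP[/eqP ek _].
by case: h; exists e.
Qed.

Lemma lam_fast k : k < n ->
  \sum_(e : edge M | (lev e == k) && (tau e < lam k)) cap e < delta.
Proof.
move=> kn; case: (posnP (lam k)) => [->|lk].
  by rewrite big1 // => e; rewrite andbF.
have := lamP (lam k).-1 kn.
rewrite -[X in _ = (X <= _)](prednK lk) ltnn => /negbT.
rewrite -ltnNge; apply: leq_ltn_trans; rewrite /caplev /captau.
by apply/eq_leq/eq_bigl => e; congr (_ && _); lia.
Qed.

Lemma greedy_level k (a : player delta -> nat) :
  k < n -> (forall q, q.1 < a q) -> exists g y,
  [/\ step a g y, forall p, lev (g p) = k,
    greedy (@tau M) (@net_cap_gt0 M) (fun e => lev e == k) a g y &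
    forall p e, lev e == k -> tau e < lam k -> lam k <= tau (g p) ->
      y p < exit a y g p e].
Proof.
move=> kn va; have [e1 /eqP he1] := level_edge kn.
pose ex p (G : player delta -> edge M * nat) e :=
  exit a (fun q => (G q).2) (fun q => (G q).1) p e.
(* Doubling the exit stage makes the order lexicographic: earliest exit first, then fast edges on
   ties. Hence a player on a slow edge would exit strictly later on any fast one. *)
pose best p G :=
  [arg min_(e < e1 | lev e == k) ((ex p G e).*2 + (lam k <= tau e))].
have [p G G' hG|G hG] := @measure_fix _ _ (e1, 0) (rank a)
    (fun p G => (best p G, ex p G (best p G))).
  have ee : ex p G = ex p G'.
    apply/funext => e; apply: exit_congr => // q qp _.
    by rewrite hG // before_rank.
  by rewrite /best ee.
exists (fun q => (G q).1), (fun q => (G q).2).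
have bestP p : lev (G p).1 = k /\ forall e, lev e == k ->
    (G p).2.*2 + (lam k <= tau (G p).1) <= (ex p G e).*2 + (lam k <= tau e).
  rewrite hG /= /best; case: arg_minnP => // e /eqP ek emin.
  by split=> // e' /emin.
split=> [p|p|p e ek|p e ek te tg].
- by rewrite hG.
- by case: (bestP p).
- have := (bestP p).2 e ek; rewrite /ex /=; lia.
- have := (bestP p).2 e ek; rewrite tg [lam k <= tau e]leqNgt te /ex /=; lia.
Qed.

(** Once arrivals at [node k] lag departures by exactly [lamsum k], [greedy_steady] gives the same
    at [node k.+1] from a later generation on. *)
Lemma worst_ufr : exists2 sigma : profile M delta, ufr sigma &
  exists T, forall p, T <= p.1 -> latency sigma p = lamsum n.
Proof.
have [e0 _] := edge_ex M.
have [k a kn va|g [x [x0 xs]]] := @levels_ex M n delta e0 (fun k a g y =>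
  [/\ step a g y, forall p, lev (g p) = k,
    greedy (@tau M) (@net_cap_gt0 M) (fun e => lev e == k) a g y &
    forall p e, lev e == k -> tau e < lam k -> lam k <= tau (g p) ->
      y p < exit a y g p e]).
  have [g [y h]] := greedy_level kn va; exists g, y; split=> //.
  by case: h => st _ _ _; apply: step_valid st.
have [sigma hs] : exists sigma, forall k, k < n -> choice_at e0 sigma k = g k.
  by apply: profile_of => k p kn; have [_ ->] := xs k kn.
have xf : follows n e0 sigma x.
  by split=> // k kn; rewrite hs //; have [] := xs k kn.
have xg : locally_greedy n lev e0 sigma x.
  by move=> k kn; rewrite hs //; have [] := xs k kn.
have xE k : k <= n -> (outcome sigma)^~ k = x^~ k.
  by move=> kn; apply/funext => p; rewrite /= (outcomeE layM p xf).
exists sigma.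
  apply: (greedy_ufr layM (e0 := e0)) => k kn.
  by rewrite !xE ?(ltnW kn) //; apply: xg.
have xo := greedy_levels_orderly layM xf xg.
have xb := greedy_levels_bound xf xg.
suff h k : k <= n ->
    exists T, forall p, T <= p.1 -> x p k = p.1 + (1 + lamsum k).
  have [T hT] := h n (leqnn n); exists T => p /hT xp.
  apply/eqP; rewrite -(eqn_add2r (departure p)) (latencyE layM e0).
  by rewrite (outcomeE layM p xf) // xp /departure; apply/eqP; lia.
elim: k => [_|k IH kn].
  by exists 0 => p _; rewrite xf.1 /departure /lamsum big_ord0; lia.
have [T hT] := IH (ltnW kn).
have -> : 1 + lamsum k.+1 = 1 + lamsum k + lam k.
  by rewrite lamsumS addnA.
have [st lg gr fp] := xs k kn.
apply: (greedy_steady (A := fun e => lev e == k) _ st _ (xo k (ltnW kn))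
  (lam_fast kn) hT _ fp).
- by move=> q; apply: (follows_valid xf q (ltnW kn)).
- by move=> p; rewrite lg.
- by move=> p; apply: leq_trans (xb _ kn p) _; rewrite lamsumS !addnA.
Qed.

End Values.

(** * Values of the game *)

Section Averages.
Variables (R : realType) (M : network) (delta : nat).
Implicit Types sigma : profile M delta.

(** The constant changes the average by [K / T], which is below any [eps] for large [T]. *)
Lemma limn_einf_avg_ge sigma v K :
  (forall T, T * v <= \sum_(t < T) gen_latency sigma t + K) ->
  ((v%:R : R)%:E <= limn_einf (avg_latency R sigma))%E.
Proof.
move=> hv; rewrite limn_einf_lim; apply/lee_subgt0Pr => eps eps0.
apply: lime_ge; first exact: is_cvg_einfs.
near=> m; apply: le_ereal_inf_tmp => _ [T /= mT <-].
have m0 : 0 < m by near: m; exact: nbhs_infty_gt.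
have T0 : (0 < T%:R :> R)%R by rewrite ltr0n (leq_trans m0).
rewrite /avg_latency -EFinB lee_fin ler_pdivlMr // mulrBl.
have Keps : (K%:R <= eps * T%:R)%R.
  rewrite -ler_pdivrMl //.
  apply: (@le_trans _ _ m%:R%R); last by rewrite ler_nat.
  by near: m; exact: nbhs_infty_ger.
have := hv T; rewrite -(ler_nat R) natrD natrM mulrC => hT.
rewrite lerBlDr (le_trans hT) // lerD2l //.
Unshelve. all: by end_near. Qed.

Lemma limn_esup_avg_le sigma v :
  (forall T, \sum_(t < T) gen_latency sigma t <= T * v) ->
  (limn_esup (avg_latency R sigma) <= (v%:R : R)%:E)%E.
Proof.
move=> hv; rewrite limn_esup_lim; apply: lime_le; first exact: is_cvg_esups.
apply: nearW => m; apply: ge_ereal_sup => _ [T _ <-].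
rewrite /avg_latency lee_fin; case: (posnP T) => [->|T0].
  by rewrite big_ord0 mul0r.
by rewrite ler_pdivrMr ?ltr0n // -natrM ler_nat mulnC.
Qed.

End Averages.

Section LayeredValues.
Variables (R : realType) (M : network) (n : nat) (lev : edge M -> nat).
Variables (node : nat -> vertex M) (delta : nat) (lam : nat -> nat).
Hypothesis layM : layered n lev node.
Hypothesis lamP : forall k l, k < n -> (delta <= caplev lev k l) = (lam k <= l).

(** The uniform profile attains the lower bound common to all profiles, so it is optimal, and the
    limit of any other optimal profile is squeezed to the same value. *)
Lemma Opt_layered : Opt R M delta = ((optval n lev delta lam)%:R)%:E.
Proof.
set v := optval _ _ _ _.
have low (sigma : profile M delta) :
    ((v%:R : R)%:E <= limn_einf (avg_latency R sigma))%E.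
  by have [K hK] := optval_lower layM lamP sigma; apply: limn_einf_avg_ge hK.
have [sigma hs] := optval_upper layM lamP.
have up : (limn_esup (avg_latency R sigma) <= (v%:R : R)%:E)%E.
  apply: limn_esup_avg_le => T.
  rewrite (eq_bigr (fun=> v)) => [|t _]; last by rewrite hs.
  by rewrite big_const_ord iter_addn_0 mulnC.
have cv : (avg_latency R sigma @ \oo --> (v%:R : R)%:E)%classic.
  apply: cvg_near_cst; near=> T; rewrite /avg_latency; apply/eqP.
  have T0 : 0 < T by near: T; exact: nbhs_infty_gt.
  rewrite (eq_bigr (fun=> v)) => [|t _]; last by rewrite hs.
  by rewrite big_const_ord iter_addn_0 natrM mulfK // pnatr_eq0 -lt0n.
rewrite /Opt; apply: xget_unique.
  by exists sigma => // sigma'; apply: le_trans up (low sigma').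
move=> w [sigma' so' cv']; apply/eqP; rewrite eq_le.
have [i1 s1] := cvg_limn_einf_sup cv; have [i2 s2] := cvg_limn_einf_sup cv'.
apply/andP; split; last by rewrite -i2 low.
by rewrite -s2 (le_trans (so' sigma)) // i1.
Unshelve. all: by end_near. Qed.

Hypothesis delta_gt0 : 0 < delta.

Lemma WEq_layered : WEq R M delta = ((delta * lamsum lam n)%:R)%:E.
Proof.
apply/eqP; rewrite eq_le; apply/andP; split.
  apply: ge_ereal_sup => _ [sigma us <-]; apply: limn_esup_avg_le => T.
  apply: (@leq_trans (\sum_(t < T) delta * lamsum lam n)).
    apply: leq_sum => t _; apply: (@leq_trans (\sum_(i < delta) lamsum lam n)).
      by apply: leq_sum => i _; apply: (ufr_latency layM lamP).
    by rewrite big_const_ord iter_addn_0 mulnC.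
  by rewrite big_const_ord iter_addn_0 mulnC.
have [sigma us [T0 hT0]] := worst_ufr layM lamP delta_gt0.
apply: le_trans (ereal_sup_ubound _); last by exists sigma.
apply: le_trans (limn_einf_sup _).
(* The constant makes up for the first [T0] generations, which may pay less. *)
apply: (@limn_einf_avg_ge _ _ _ _ _ (T0 * (delta * lamsum lam n))) => T.
elim: T => [|T IH]; first by rewrite mul0n.
rewrite big_ord_recr /= mulSn.
have [T0T|TT0] := leqP T0 T.
  have -> : gen_latency sigma T = delta * lamsum lam n; last first.
    by rewrite addnAC [leqRHS]addnC leq_add2l.
  rewrite /gen_latency (eq_bigr (fun=> lamsum lam n)) => [|i _].
    by rewrite big_const_ord iter_addn_0 mulnC.
  exact: hT0.
by rewrite -mulSn (leq_trans _ (leq_addl _ _)) // leq_mul2r TT0 orbT.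
Qed.

End LayeredValues.

(** * Chains of parallel networks are layered *)

Lemma parallel_layered (N : network) : parallel N ->
  layered 1 (fun=> 0) (fun k => if k is 0 then src N else dst N).
Proof.
move=> pN; have vN v : v = src N \/ v = dst N.
  have [r hr] := net_cover v; have := pN r hr.
  case: r hr => [|e [|]] //= /andP[_ /eqP ed] _.
  by rewrite /walk_vertices /= ed !inE => /orP[/eqP|/eqP]; [left|right].
split=> // [e|e|].
- by case: (vN (etail e)) => // te; have := net_dst_in e; rewrite te eqxx.
- by case: (vN (ehead e)) => // te; have := net_src_out e; rewrite te eqxx.
have sd := negPf (net_src_neq_dst N).
by move=> [|[|//]] [|[|//]] //= _ _ /eqP; rewrite ?[dst N == _]eq_sym sd.
Qed.

Lemma chain_layered (N : nat -> network) n :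
  (forall h, h <= n -> parallel (N h)) ->
  exists node, layered n.+1 (@chain_module N n) node.
Proof.
elim: n => [|n IH] pN; first by eexists; apply: parallel_layered; apply: pN.
have [h hn|node lay] := IH; first by apply: pN; apply: leqW.
have layN := parallel_layered (pN n.+1 (leqnn _)).
have dN : dst (N n.+1) != src (N n.+1) by rewrite eq_sym net_src_neq_dst.
have dE : ser_dst (chain N n) (N n.+1) =
    inr (exist (fun v => v != src (N n.+1)) _ dN) by apply: ser_inrE.
(* The source of the new module is [node n.+1] of the old chain, so only its destination is
   added. *)
exists (fun k =>
  if k <= n.+1 then inl (node k) else ser_dst (chain N n) (N n.+1)).
split=> [[e|e]|[e|e]|[e|e]|||k k'] //=.
- exact: ltnW (layered_lt lay e).
- by rewrite (layered_tail lay) ltnW // (layered_lt lay).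
- by rewrite (layered_tail layN) leqnn ser_inr_src (layered_dst lay).
- by rewrite (layered_head lay) (layered_lt lay).
- by rewrite (layered_head layN) ltnn.
- by rewrite (layered_src lay).
- by rewrite ltnn.
rewrite !inE => kn kn'; rewrite dE.
case: (leqP k n.+1) => h; case: (leqP k' n.+1) => h' //; last by lia.
by case=> /(layered_inj lay); apply.
Qed.

Lemma chain_sum (N : nat -> network) n h (F : nat -> nat -> nat) : h <= n ->
  \sum_(e : edge (chain N n) | chain_module e == h) F (tau e) (cap e) =
  \sum_(e : edge (N h)) F (tau e) (cap e).
Proof.
elim: n h => [|n IH] h; first by case: h.
rewrite big_sumType /= leq_eqVlt => /orP[/eqP ->|hn].
  rewrite eqxx big1 ?add0n // => e /eqP en.
  suff : chain_module e <= n by rewrite en ltnn.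
  by elim: n e {IH en} => //= n IH [e|e] /=; rewrite ?ltnSn // leqW.
by rewrite IH // [X in _ + X]big1 ?addn0 // => e; rewrite gtn_eqF.
Qed.

(** At the maximal transit cost every edge counts, so a least sufficient cost exists; monotonicity
    gives the equivalence. *)
Lemma threshold_ex (M : network) delta : delta <= \sum_(e : edge M) cap e ->
  exists lam,
    forall l, (delta <= captau (@tau M) (@cap M) xpredT l) = (lam <= l).
Proof.
move=> hd; set C := captau _ _ _.
have Cmono l l' : l <= l' -> C l <= C l'.
  move=> ll; rewrite /C /captau [leqLHS]big_mkcond [leqRHS]big_mkcond /=.
  by apply: leq_sum => e _; case: (leqP (tau e) l) => // /leq_trans/(_ ll) ->.
have ex : exists l, delta <= C l.
  exists (\max_(e : edge M) tau e); rewrite /C /captau (eq_bigl xpredT) // => e.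
  by rewrite /= leq_bigmax.
exists (ex_minn ex) => l; case: ex_minnP => m hm mmin.
by apply/idP/idP => [/mmin //|/Cmono]; apply: leq_trans.
Qed.

Theorem theorem4p2 (R : realType) (H : nat) (N : nat -> network) (hstar : nat)
    (gstar : nat) :
  (1 <= H)%N ->
  (forall h : nat, (h < H)%N -> parallel (N h)) ->
  (hstar < H)%N ->
  is_min_cut (module_edges N H hstar) ->
  gstar = capacity [set: edge (N hstar)]%SET ->
  Opt R (Nser N H) gstar = (\sum_(0 <= h < H) Opt R (N h) gstar)%E /\
  WEq R (Nser N H) gstar = (\sum_(0 <= h < H) WEq R (N h) gstar)%E.
Proof.
case: H => // n _ pN hn [_ mincut] gE; rewrite /Nser /= in mincut *.
have [node lay] := chain_layered pN.
have capE h : h <= n ->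
    capacity (module_edges N n.+1 h) = \sum_(e : edge (N h)) cap e.
  move=> hh; rewrite /capacity -(chain_sum N (fun _ c => c) hh).
  by apply: eq_bigl => e; rewrite inE.
have gstarE : gstar = \sum_(e : edge (N hstar)) cap e.
  by rewrite gE /capacity; apply: eq_bigl => e; rewrite inE.
have g0 : 0 < gstar.
  have [e0 _] := edge_ex (N hstar).
  by rewrite gstarE (bigD1 e0) //= addn_gt0 net_cap_gt0.
(* Every module is a cut, so the minimum cut bounds the inflow by the capacity of each module, as
   thresholds [lam h] require. *)
have gle h : h < n.+1 -> gstar <= \sum_(e : edge (N h)) cap e.
  move=> hh; rewrite gstarE -!capE //; apply: mincut => r hr.
  have [e0 _] := edge_ex (chain N n).
  pose rr : route (chain N n) := exist (fun r => is_route r) r hr.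
  exists (nth e0 r h); first by rewrite mem_nth // (route_size lay rr).
  by rewrite inE (route_lev lay e0 rr).
have [lam hlam] : {lam : nat -> nat & forall h, h < n.+1 ->
    forall l,
      (gstar <= captau (@tau (N h)) (@cap (N h)) xpredT l) = (lam h <= l)}.
  apply: (@choice _ _ (fun h lm => h < n.+1 -> forall l,
    (gstar <= captau (@tau (N h)) (@cap (N h)) xpredT l) = (lm <= l))) => h.
  have [hh|_] := ltnP h n.+1; last by exists 0.
  by have [lm hlm] := threshold_ex (gle h hh); exists lm.
have clev h l : h < n.+1 -> caplev (@chain_module N n) h l =
    captau (@tau (N h)) (@cap (N h)) xpredT l.
  move=> hh; rewrite /caplev /captau.
  rewrite big_mkcondr (chain_sum N (fun t c => if t <= l then c else 0)) //.
  by rewrite -big_mkcond.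
have lamP k l : k < n.+1 ->
    (gstar <= caplev (@chain_module N n) k l) = (lam k <= l).
  by move=> kn; rewrite clev // hlam.
(* Module [h] on its own, as a chain with one level, has the same threshold [lam h]. *)
have lamN h : h < n.+1 -> forall k l, k < 1 ->
    (gstar <= @caplev (N h) (fun=> 0) k l) = ((fun=> lam h) k <= l).
  by move=> hh [|//] l _; rewrite -(hlam h).
have N1 h : h < n.+1 -> layered 1 (fun=> 0)
    (fun k => if k is 0 then src (N h) else dst (N h)).
  by move=> hh; apply/parallel_layered/pN.
split.
  rewrite (Opt_layered R lay lamP) [RHS]big_nat.
  rewrite (eq_bigr (fun h => ((\sum_(l < lam h)
      (gstar - captau (@tau (N h)) (@cap (N h)) xpredT l))%:R : R)%:E)).
    rewrite -big_nat sumEFin big_mkord -natr_sum; congr (_%:R%:E)%R.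
    apply: eq_bigr => k _; apply: eq_bigr => l _.
    by rewrite clev.
  move=> h /= hh; rewrite (Opt_layered R (N1 h hh) (lamN h hh)).
  by rewrite /optval big_ord1.
rewrite (WEq_layered R lay lamP g0) [RHS]big_nat.
rewrite (eq_bigr (fun h => ((gstar * lam h)%:R : R)%:E)).
  by rewrite -big_nat sumEFin big_mkord -natr_sum /lamsum big_distrr.
move=> h /= hh.
by rewrite (WEq_layered R (N1 h hh) (lamN h hh) g0) /lamsum big_ord1.
Qed.
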